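(* For every $\rho>0$ there is a constant $C_\rho>0$, depending only on $\rho$, and there is a universal constant $K>0$, such that the following holds. Let $N\geq 2$ be an integer with $0<\rho<\log^3(N)$, let $\Phi=(\phi_1,\dots,\phi_N)\in\mathbb{C}^{N\times N}$ and $\Psi=(\psi_1,\dots,\psi_N)\in\mathbb{C}^{N\times N}$ be orthonormal bases, let $c\in\mathbb{C}^N$ be a random Rademacher or Steinhaus sequence, and let $C\in\mathbb{C}^{N\times N}$ be the diagonal matrix with diagonal $c$. Let $\alpha\in\mathbb{C}^N$ be an $s$-sparse vector, let $\Omega=\{l_1,\dots,l_m\}$ consist of $m$ indices chosen independently and uniformly at random from $\{1,\dots,N\}$ (independently of $c$), put $A^{\mathrm c}=\Phi^*C\Psi$ and $y=A^{\mathrm c}_\Omega\,\alpha\in\mathbb{C}^m$. If $$m\geq C_\rho\, N\,\beta^2(\Phi,\Psi)\, s\,\log^5(N),$$ then, with probability at least $1-K N^{-\rho}$ (over the draw of $c$ and $\Omega$), $\alpha$ is the unique minimizer of the $\ell_1$-minimization problem $$\min_{\alpha'\in\mathbb{C}^N}\|\alpha'\|_1\quad\text{subject to}\quad y=A^{\mathrm c}_\Omega\,\alpha'.$$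
   Context: An orthonormal basis of $\mathbb{C}^N$ is identified with the unitary matrix whose columns are the basis vectors; $\phi_{ki}$ and $\psi_{kj}$ denote the $k$-th entries of $\phi_i$ and $\psi_j$. $\cdot^*$ denotes the conjugate transpose (complex conjugate for scalars), $\|\alpha\|_1=\sum_{i=1}^N|\alpha_i|$ with $|\cdot|$ the complex magnitude, and $\log$ is the natural logarithm. A Rademacher sequence is a vector of independent entries, each uniform on $\{-1,+1\}$; a Steinhaus sequence is a vector of independent entries, each uniform on the complex unit circle. A vector is $s$-sparse ($s\geq 1$) if it has at most $s$ non-zero entries. For a matrix $A$ with $N$ rows, $A_\Omega$ is the matrix with $m$ rows whose $r$-th row is the $l_r$-th row of $A$, $r=1,\dots,m$ (indices may be repeated). Thus $A^{\mathrm c}_\Omega=\Phi^*_\Omega C\Psi\in\mathbb{C}^{m\times N}$. The modulus-coherence of $(\Phi,\Psi)$ is $$\beta(\Phi,\Psi)=\max_{1\leq i,j\leq N}\sqrt{\sum_{k=1}^N|\phi_{ki}^*\psi_{kj}|^2}.$$ *)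

(* Defs.v *)
From HB Require Import structures.
From mathcomp Require Import all_boot all_order all_algebra complex.
From mathcomp Require Import all_classical all_reals all_analysis.

Set Implicit Arguments.
Unset Strict Implicit.
Unset Printing Implicit Defensive.

Import Order.TTheory GRing.Theory Num.Theory.
Import numFieldNormedType.Exports.

Local Open Scope classical_set_scope.
Local Open Scope ring_scope.
Import ComplexField.Normc.
Local Open Scope sesquilinear_scope.

(* An orthonormal basis of C^N is a matrix Phi with Phi \is unitarymx, the basis
   vectors being the columns of Phi; vectors of C^N are column vectors. The
   complex magnitude is normc, whose values are in R (the norm `|z| of R[i] has
   its values in R[i]). *)

Section sensing.
Context {R : realType}.
Implicit Types (m N s : nat).

Definition norm1 N (x : 'cV[R[i]]_N) : R := \sum_(i < N) normc (x i 0).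

Definition sparse N s (x : 'cV[R[i]]_N) : Prop :=
  (#|[set i | (x i 0 != 0)%R]%SET| <= s)%N.

(* 0 is neutral for the max here, since all the terms are nonnegative. *)
Definition modulus_coherence N (Phi Psi : 'M[R[i]]_N) : R :=
  \big[Num.max/0]_(i < N) \big[Num.max/0]_(j < N)
    Num.sqrt (\sum_(k < N) normc ((Phi k i)^* * Psi k j) ^+ 2).

Definition modulated N (Phi Psi : 'M[R[i]]_N) (c : 'I_N -> R[i]) : 'M[R[i]]_N :=
  Phi^t* *m diag_mx (\row_k c k) *m Psi.

Definition l1_minimizer m N (A : 'M[R[i]]_(m, N)) (y : 'cV[R[i]]_m)
    (x : 'cV[R[i]]_N) : Prop :=
  y = A *m x /\ forall x', y = A *m x' -> norm1 x <= norm1 x'.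

Definition unique_l1_minimizer m N (A : 'M[R[i]]_(m, N)) (y : 'cV[R[i]]_m)
    (x : 'cV[R[i]]_N) : Prop :=
  l1_minimizer A y x /\ forall x', l1_minimizer A y x' -> x' = x.

End sensing.

Definition borelC (R : realType) := g_sigma_algebraType (@open R[i]^o).

Section random.
Context {R : realType} d {T : measurableType d} (P : probability T R).

Definition rademacher (X : {RV P >-> borelC R}) : Prop :=
  P (X @^-1` [set (1 : R[i])]) = (2^-1)%:E /\
  P (X @^-1` [set (-1 : R[i])]) = (2^-1)%:E.

Definition unit_circle (t : R) : R[i] :=
  (cos (2 * pi * t) +i* sin (2 * pi * t))%C.

(* The uniform law on the unit circle is the law of exp(2 pi i t) for t uniform
   on [0, 1]. *)
Definition steinhaus (X : {RV P >-> borelC R}) : Prop :=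
  forall A : set (borelC R), measurable A ->
    distribution P X A = uniform_prob (@ltr01 R) (unit_circle @^-1` A).

(* 'I_N carries no measurable structure in the library: measurability of a
   random index is measurability of its level sets. *)
Definition uniform_index N (l : T -> 'I_N) : Prop :=
  forall k : 'I_N,
    measurable (l @^-1` [set k]) /\ P (l @^-1` [set k]) = (N%:R^-1)%:E.

Definition mutually_independent (I : finType) (F : I -> set (set T)) : Prop :=
  forall (J : {set I}) (E : I -> set T), (forall i, i \in J -> F i (E i)) ->
    P (\bigcap_(i in [set` J]) E i) = (\prod_(i in J) P (E i))%E.

(* The family (c_1, ..., c_N, l_1, ..., l_m) is mutually independent, each
   variable being represented by the sigma-algebra it generates. *)
Definition independent_draws N m (c : 'I_N -> {RV P >-> borelC R})
    (l : 'I_m -> T -> 'I_N) : Prop :=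
  mutually_independent (fun i : 'I_N + 'I_m => match i with
    | inl k => preimage_set_system setT (c k) (@measurable _ (borelC R))
    | inr r => preimage_set_system setT (l r) [set: set 'I_N]
    end).

End random.

(* Main.v *)
Require Import Defs.
From HB Require Import structures.
From mathcomp Require Import all_boot all_order all_algebra complex.
From mathcomp Require Import all_classical all_reals all_analysis.
Import Order.TTheory GRing.Theory Num.Theory.
Import numFieldNormedType.Exports.
Local Open Scope classical_set_scope.
Local Open Scope ring_scope.
From mathcomp Require Import measurable_realfun ring lra.

Set Implicit Arguments.
Unset Strict Implicit.
Unset Printing Implicit Defensive.

(** The law of c is invariant under changing the signs of its entries, so that
    the failure probability is an average, over c, of the proportion of failing
    pairs (signs, rows); this proportion is bounded for every fixed c of modulus
    one. For most signs, a Bernstein bound makes all the entries of the unitary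
    matrix U = Phi^* C Psi of size O(beta log N). For such a U, the golfing
    scheme with about log N batches of rows, contracting the uniform norm by 4
    at each step, yields an inexact dual certificate for the sign of alpha, and
    also one for every basis vector of the support. The latter make the sampled
    columns on the support injective, so that no restricted isometry estimate
    is needed. *)

(** The coherence controls only the l2 norm over [k] of the products of entries of Phi and Psi,
    whereas golfing needs a bound on every entry of U; the random signs turn the first into the
    second at the price of a logarithm. Injectivity obtained from certificates is weak: the part of
    a kernel vector on the support is bounded, in l1 norm, only by a multiple of |S| times its part
    off the support. The certificates must therefore be accurate to about 1/N on S, which fixes the
    number of batches, while the constant accuracy 1/3 is enough off S. Once c is fixed up to signs,
    signs and rows range over finite sets, so all concentration is done by counting, and batches are
    separated by splitting functions instead of conditioning. Measure theory enters only at the end,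
    where failure has to be an event: it quantifies over uncountably many competitors, and
    compactness reduces them to rational ones. *)

(** * The complex modulus with real values *)

Section complex_modulus.
Context {R : realType}.
Implicit Types x y z : R[i].
Local Notation normc := (@ComplexField.Normc.normc R).

Lemma normrE x : `|x| = (normc x)%:C%C.
Proof. by rewrite normc_def; case: x. Qed.

Lemma normc_ge0 x : 0 <= normc x.
Proof. by case: x => a b; exact: sqrtr_ge0. Qed.

Lemma normcM x y : normc (x * y) = normc x * normc y.
Proof. exact: ComplexField.Normc.normcM. Qed.

Lemma ler_normcD x y : normc (x + y) <= normc x + normc y.
Proof. by have := ler_normD x y; rewrite !normrE -rmorphD /= lecR. Qed.

Lemma normcN x : normc (- x) = normc x.
Proof. by apply: complexI; rewrite -!normrE normrN. Qed.

Lemma ler_normcB x y : normc (x - y) <= normc x + normc y.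
Proof. by rewrite -(normcN y) ler_normcD. Qed.

Lemma normc0 : normc 0 = 0.
Proof. exact: ComplexField.Normc.normc0. Qed.

Lemma normc1 : normc 1 = 1.
Proof. exact: ComplexField.Normc.normc1. Qed.

Lemma normc_eq0 x : (normc x == 0) = (x == 0).
Proof. by rewrite -(inj_eq (@complexI R)) -normrE normr_eq0. Qed.

Lemma normcJ x : normc x^* = normc x.
Proof. by apply: complexI; rewrite -!normrE norm_conjC. Qed.

Lemma normcR (a : R) : normc a%:C%C = `|a|.
Proof. by rewrite /ComplexField.Normc.normc /= expr0n addr0 sqrtr_sqr. Qed.

Lemma ler_normc_sum (I : Type) (r : seq I) (P : pred I) (F : I -> R[i]) :
  normc (\sum_(i <- r | P i) F i) <= \sum_(i <- r | P i) normc (F i).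
Proof.
elim/big_rec2 : _ => [|i b a _ ab]; first by rewrite normc0.
by rewrite (le_trans (ler_normcD _ _))// lerD2l.
Qed.

Lemma ReD x y : complex.Re (x + y) = complex.Re x + complex.Re y.
Proof. by case: x y => a b [c e]. Qed.

Lemma ImD x y : complex.Im (x + y) = complex.Im x + complex.Im y.
Proof. by case: x y => a b [c e]. Qed.

Lemma ReN x : complex.Re (- x) = - complex.Re x.
Proof. by case: x. Qed.

Lemma ImN x : complex.Im (- x) = - complex.Im x.
Proof. by case: x. Qed.

Lemma ReM x y :
  complex.Re (x * y) = complex.Re x * complex.Re y - complex.Im x * complex.Im y.
Proof. by case: x y => a b [c e]. Qed.

Lemma ImM x y :
  complex.Im (x * y) = complex.Re x * complex.Im y + complex.Im x * complex.Re y.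
Proof. by case: x y => a b [c e]. Qed.

Lemma Re_sum (I : Type) (r : seq I) (P : pred I) (F : I -> R[i]) :
  complex.Re (\sum_(i <- r | P i) F i) = \sum_(i <- r | P i) complex.Re (F i).
Proof. by elim/big_rec2 : _ => [//|i b a _ <-]; rewrite ReD. Qed.

Lemma Im_sum (I : Type) (r : seq I) (P : pred I) (F : I -> R[i]) :
  complex.Im (\sum_(i <- r | P i) F i) = \sum_(i <- r | P i) complex.Im (F i).
Proof. by elim/big_rec2 : _ => [//|i b a _ <-]; rewrite ImD. Qed.

Lemma normc_sqr x : normc x ^+ 2 = complex.Re x ^+ 2 + complex.Im x ^+ 2.
Proof. by case: x => a b; rewrite sqr_sqrtr// addr_ge0// sqr_ge0. Qed.

Lemma normc_sqrE x : (normc x ^+ 2)%:C%C = x * x^*.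
Proof. by rewrite -normCK normrE rmorphXn. Qed.

Lemma ler_Re_normc x : `|complex.Re x| <= normc x.
Proof.
rewrite -ler_sqr ?nnegrE ?normc_ge0// normc_sqr real_normK ?num_real//.
by rewrite lerDl sqr_ge0.
Qed.

Lemma ler_Im_normc x : `|complex.Im x| <= normc x.
Proof.
rewrite -ler_sqr ?nnegrE ?normc_ge0// normc_sqr real_normK ?num_real//.
by rewrite lerDr sqr_ge0.
Qed.

Lemma ler_normc_ReIm x : normc x <= `|complex.Re x| + `|complex.Im x|.
Proof.
rewrite -ler_sqr ?nnegrE ?normc_ge0 ?addr_ge0// normc_sqr sqrrD !real_normK ?num_real//.
by rewrite addrAC lerDl mulrn_wge0// mulr_ge0.
Qed.

End complex_modulus.

(** * Recovery from inexact dual certificates *)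

Section recovery.
Context {R : realType} (N : nat).
Local Notation C := R[i].
Local Notation normc := (@ComplexField.Normc.normc R).
Implicit Types (U : 'M[C]_N) (D S : {set 'I_N}) (w : 'I_N -> C) (a b : R).

(* The certificate is a combination of the rows of U indexed by D. It is used
   through the bilinear pairing, so its target on S is the conjugate of the
   usual one. *)
Definition dual_certificate U D S w a b : Prop :=
  exists y : 'I_N -> C, (forall i, i \notin D -> y i = 0) /\
  forall j, if j \in S then normc (\sum_i y i * U i j - w j) <= a
            else normc (\sum_i y i * U i j) <= b.

(** A combination of rows that annihilate [h] annihilates [h]. Hence the pairing of [w] with [h] on
    [S] is, up to sign, the error of the certificate on [S] plus its values off [S], both paired
    with [h]. *)
Lemma dual_certificate_pairing U D S w a b (h : 'I_N -> C) : 
  dual_certificate U D S w a b ->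
  (forall i, i \in D -> \sum_j U i j * h j = 0) ->
  normc (\sum_(j in S) w j * h j) <=
    a * \sum_(j in S) normc (h j) + b * \sum_(j | j \notin S) normc (h j).
Proof.
move=> [y [yD yS]] hD.
pose v j := \sum_i y i * U i j.
have vh0 : \sum_j v j * h j = 0.
  under eq_bigr do rewrite mulr_suml.
  rewrite exchange_big big1//= => i _.
  under eq_bigr do rewrite -mulrA.
  rewrite -mulr_sumr; have [iD|/yD->] := boolP (i \in D); last by rewrite mul0r.
  by rewrite hD// mulr0.
have -> : \sum_(j in S) w j * h j =
    - (\sum_(j in S) (v j - w j) * h j + \sum_(j | j \notin S) v j * h j).
  apply/eqP; rewrite -subr_eq0 opprK addrA -big_split/=.
  rewrite (eq_bigr (fun j => v j * h j)); last by move=> j _; ring.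
  by move: vh0; rewrite (bigID (mem S))/= => ->.
rewrite normcN (le_trans (ler_normcD _ _))// lerD//.
  rewrite mulr_sumr (le_trans (ler_normc_sum _ _ _))// ler_sum// => j jS.
  by rewrite normcM ler_wpM2r ?normc_ge0//; have := yS j; rewrite jS.
rewrite mulr_sumr (le_trans (ler_normc_sum _ _ _))// ler_sum// => j jS.
by rewrite normcM ler_wpM2r ?normc_ge0//; have := yS j; rewrite (negbTE jS).
Qed.

(** Multiplying [x] by it gives the modulus of [x], as the bilinear pairing requires. Division by
    zero makes it 0 at 0, so the sign of alpha vanishes off the support. *)
Definition conj_sign (x : C) : C := x^* / `|x|.

Lemma normc_conj_sign x : x != 0 -> normc (conj_sign x) = 1.
Proof.
move=> x0; apply: complexI; rewrite -normrE normrM normfV norm_conjC normr_id.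
by rewrite divff// normr_eq0.
Qed.

Lemma conj_signM x : x != 0 -> conj_sign x * x = (normc x)%:C%C.
Proof.
move=> x0; rewrite -normrE /conj_sign mulrAC [_^* * _]mulrC -normCK expr2 mulfK//.
by rewrite normr_eq0.
Qed.

(* The certificates for the basis vectors make the rows in D injective on S,
   which replaces a restricted isometry estimate. *)
Lemma certificates_recovery m U (lam : 'I_m -> 'I_N) (alpha : 'cV[C]_N) D S a :
  S = [set i | alpha i 0 != 0]%SET -> (forall i, i \in D -> exists r, lam r = i) ->
  0 <= a -> a * #|S|%:R <= 2^-1 ->
  dual_certificate U D S (fun j => conj_sign (alpha j 0)) a 3^-1 ->
  (forall k, k \in S -> dual_certificate U D S (fun j => (j == k)%:R) a 3^-1) ->
  unique_l1_minimizer (rowsub lam U) (rowsub lam U *m alpha) alpha.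
Proof.
move=> SE lamD a0 aS csgn cdelta.
have norm1E (x : 'cV[C]_N) :
    norm1 x = \sum_(j in S) normc (x j 0) + \sum_(j | j \notin S) normc (x j 0).
  by rewrite /norm1 (bigID (mem S)).
(* The strict inequality yields minimality and uniqueness together. *)
have key (x : 'cV[C]_N) : rowsub lam U *m alpha = rowsub lam U *m x ->
    x != alpha -> norm1 alpha < norm1 x.
  move=> Ax xalpha.
  pose h j := x j 0 - alpha j 0.
  have hD i : i \in D -> \sum_j U i j * h j = 0.
    move=> /lamD[r <-]; have /matrixP /(_ r 0) := Ax; rewrite !mxE => /eqP.
    rewrite eq_sym -subr_eq0 -sumrB => /eqP hE; rewrite -[RHS]hE.
    by apply: eq_bigr => j _; rewrite !mxE mulrBr.
  set HS := \sum_(j in S) normc (h j).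
  set HT := \sum_(j | j \notin S) normc (h j).
  have HS0 : 0 <= HS by apply: sumr_ge0 => j _; exact: normc_ge0.
  have HT0 : 0 <= HT by apply: sumr_ge0 => j _; exact: normc_ge0.
  (* The basis certificate at [k] bounds the modulus of [h k] by a * HS + HT / 3. Summed over [S],
     the first term is at most HS / 2 and is absorbed on the left, whence the factor 2/3. *)
  have HSle : HS <= (2/3) * #|S|%:R * HT.
    suff : HS <= #|S|%:R * (a * HS + 3^-1 * HT).
      have : a * #|S|%:R * HS <= 2^-1 * HS by rewrite ler_wpM2r.
      by rewrite mulrDr (mulrC a) !mulrA; lra.
    rewrite mulr_natl -sumr_const /HS ler_sum// => k kS.
    have := dual_certificate_pairing (cdelta k kS) hD.
    rewrite (bigD1 k)//= eqxx mul1r big1 ?addr0//.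
    by move=> j /andP[_ /negbTE->]; rewrite mul0r.
  have Hsgn := dual_certificate_pairing csgn hD.
  rewrite -/HS -/HT in Hsgn.
  have HTgt0 : 0 < HT.
    rewrite lt_neqAle HT0 andbT eq_sym; apply/negP => /eqP HTE.
    have HSE : HS = 0 by move: HSle; rewrite HTE mulr0; lra.
    move/eqP: xalpha; apply; apply/matrixP => j k; rewrite (ord1 k).
    apply/eqP; rewrite -subr_eq0 -normc_eq0 -[_ - _]/(h j).
    have [jS|jS] := boolP (j \in S).
      by rewrite (psumr_eq0P _ HSE)// => i _; exact: normc_ge0.
    by rewrite (psumr_eq0P _ HTE)// => i _; exact: normc_ge0.
  have aHS : a * HS <= 3^-1 * HT.
    have : a * HS <= a * ((2 / 3) * #|S|%:R * HT) by rewrite ler_wpM2l.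
    have : a * #|S|%:R * HT <= 2^-1 * HT by rewrite ler_wpM2r.
    have -> : a * (2 / 3 * #|S|%:R * HT) = 2 / 3 * (a * #|S|%:R * HT) by ring.
    by lra.
  rewrite !norm1E [\sum_(j | j \notin S) normc (alpha _ _)]big1 ?addr0; last first.
    by move=> j; rewrite SE inE negbK => /eqP->; rewrite normc0.
  have -> : \sum_(j | j \notin S) normc (x j 0) = HT.
    apply: eq_bigr => j; rewrite SE inE negbK => /eqP aj0.
    by rewrite /h aj0 subr0.
  (* Multiplying x_j = alpha_j + h_j by the unimodular sign and taking real parts can only decrease
     its modulus. *)
  have : \sum_(j in S) normc (alpha j 0) +
      complex.Re (\sum_(j in S) conj_sign (alpha j 0) * h j) <=
      \sum_(j in S) normc (x j 0).
    rewrite Re_sum -big_split/= ler_sum// => j; rewrite SE inE => aj0.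
    have -> : x j 0 = alpha j 0 + h j by rewrite /h addrC subrK.
    rewrite -[leRHS]mul1r -(normc_conj_sign aj0) -normcM [conj_sign _ * (alpha j 0 + _)]mulrDr (conj_signM aj0).
    by rewrite (le_trans _ (ler_Re_normc _))// (le_trans _ (ler_norm _))// ReD.
  (* The gain HT off [S] beats the loss a * HS + HT / 3 on [S], which is at most 2/3 of HT. *)
  have := le_trans (ler_Re_normc _) Hsgn; rewrite ler_norml => /andP[+ _].
  by lra.
split=> [|x [Ax xmin]].
  split=> // x Ax; have [->//|xa] := eqVneq x alpha; exact/ltW/key.
apply/eqP/negPn/negP => xa; have := key _ Ax xa.
by rewrite ltNge xmin.
Qed.

End recovery.

(** * Tail bounds and Fubini for counts of finite functions *)

Section counting.
Context {R : realType}.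
Local Notation C := R[i].
Local Notation normc := (@ComplexField.Normc.normc R).

(** From exp x <= 1 / (1 - x) and (1 + x + 2 x^2) (1 - x) = 1 + x^2 (1 - 2 x) >= 1. *)
Lemma expR_le_quadratic (x : R) : x <= 2^-1 -> expR x <= 1 + x + 2 * x ^+ 2.
Proof.
move=> x2; have x1 : 0 < 1 - x by lra.
have : 1 - x <= expR (- x) by have := expR_ge1Dx (- x).
rewrite expRN => xinv.
have : expR x <= (1 - x)^-1.
  by rewrite -[expR x]invrK lef_pV2 ?posrE ?invr_gt0 ?expR_gt0.
move=> /le_trans; apply; rewrite -div1r ler_pdivrMr//.
have -> : (1 + x + 2 * x ^+ 2) * (1 - x) = 1 + x ^+ 2 * (1 - 2 * x) by ring.
by rewrite lerDl mulr_ge0 ?sqr_ge0//; lra.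
Qed.

Lemma leq_card_exists (K F : finType) (P : K -> pred F) :
  (#|[set f | [exists k, P k f]]%SET| <= \sum_k #|[set f | P k f]%SET|)%N.
Proof.
rewrite -sum1_card big_mkcond/=.
under [leqRHS]eq_bigr do rewrite -sum1_card big_mkcond/=.
rewrite exchange_big/= leq_sum// => f _; rewrite inE.
case: ifPn => // /existsP[k Pkf].
by rewrite (bigD1 k)//= inE Pkf.
Qed.

Section tail.
Variables (I J : finType).
Hypothesis I_gt0 : (0 < #|I|)%N.

(** Bernstein's inequality for independent uniform choices, by the Chernoff method; [V] bounds the
    total variance. The parameter [th] stays free and is chosen at each use. *)
Lemma card_sum_tail (X : J -> I -> R) (th tau V : R) : 0 <= th ->
  (forall j, \sum_i X j i = 0) -> (forall j i, th * X j i <= 2^-1) ->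
  \sum_j \sum_i X j i ^+ 2 <= #|I|%:R * V ->
  #|[set f : {ffun J -> I} | tau <= \sum_j X j (f j)]%SET|%:R <=
    #|I|%:R ^+ #|J| * expR (2 * th ^+ 2 * V - th * tau).
Proof.
move=> th0 X0 X2 XV; have I0 : 0 < #|I|%:R :> R by rewrite ltr0n.
have : #|[set f : {ffun J -> I} | tau <= \sum_j X j (f j)]%SET|%:R <=
    \sum_(f : {ffun J -> I}) expR (- (th * tau)) * \prod_j expR (th * X j (f j)).
  rewrite -sum1_card big_mkcond/= natr_sum ler_sum// => f _.
  rewrite inE -expR_sum -expRD.
  case: ifP => [tauX|_]; last exact: expR_ge0.
  by rewrite -[leLHS]expR0 ler_expR addrC subr_ge0 -mulr_sumr ler_wpM2l.
(* The sum over functions of a product is the product of the sums: this is the form that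
   independence takes. *)
move=> /le_trans; apply; rewrite -mulr_sumr -(bigA_distr_bigA (fun j i => expR (th * X j i))).
rewrite addrC expRD mulrCA ler_wpM2l ?expR_ge0//.
(* Centering removes the linear term of the quadratic bound. *)
have step j : \sum_i expR (th * X j i) <=
    #|I|%:R * expR (2 * th ^+ 2 * (\sum_i X j i ^+ 2 / #|I|%:R)).
  have : \sum_i expR (th * X j i) <=
      \sum_i (1 + th * X j i + 2 * (th * X j i) ^+ 2).
    by apply: ler_sum => i _; exact: expR_le_quadratic.
  move=> /le_trans; apply.
  rewrite !big_split/= sumr_const -mulr_sumr X0 mulr0 addr0 -mulr_suml.
  under eq_bigr do rewrite exprMn mulrA.
  rewrite -mulr_sumr -[X in X + _]mulr1 -[X in _ + X](mulfVK (lt0r_neq0 I0)).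
  rewrite [X in _ + X]mulrC -mulrDr ler_wpM2l// mulrA.
  exact: expR_ge1Dx.
apply: (@le_trans _ _ (\prod_j (#|I|%:R * expR (2 * th ^+ 2 *
    (\sum_i X j i ^+ 2 / #|I|%:R))))).
  apply: ler_prod.
  by move=> j _ /=; rewrite step sumr_ge0// => i _; exact: expR_ge0.
rewrite big_split/= prodr_const ler_wpM2l ?exprn_ge0// -expR_sum ler_expR.
rewrite -mulr_sumr ler_wpM2l ?mulr_ge0 ?sqr_ge0//.
under eq_bigr do rewrite -mulr_suml.
by rewrite -mulr_suml ler_pdivrMr// mulrC.
Qed.

(** The fourth roots of unity. Testing real parts in these directions reduces complex sums to real
    ones, with a factor 4 from the union bound and a factor 2 on the deviation. *)
Definition direction (b : bool * bool) : C :=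
  (-1) ^+ b.1 * (if b.2 then 'i%C else 1).

Lemma normc_direction b : normc (direction b) = 1.
Proof.
rewrite normcM; have -> : normc ((-1) ^+ b.1) = 1.
  by case: b.1; rewrite ?expr1 ?expr0 ?normcN normc1.
by rewrite mul1r; case: b.2; rewrite ?normc1//= expr0n expr1n add0r sqrtr1.
Qed.

Lemma normc_le_directions (x : C) (tau : R) :
  (forall b, complex.Re (direction b * x) <= tau) -> normc x <= 2 * tau.
Proof.
case: x => u v hx; apply: (le_trans (ler_normc_ReIm _)) => /=.
have := hx (false, false); have := hx (true, false).
have := hx (false, true); have := hx (true, true).
rewrite /direction/= => h1 h2 h3 h4.
have : `|u| <= tau by rewrite ler_norml; apply/andP; split; lra.
have : `|v| <= tau by rewrite ler_norml; apply/andP; split; lra.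
lra.
Qed.

Lemma card_normc_sum_tail (X : J -> I -> C) (th tau V : R) : 0 <= th ->
  (forall j, \sum_i X j i = 0) -> (forall j i, th * normc (X j i) <= 2^-1) ->
  \sum_j \sum_i normc (X j i) ^+ 2 <= #|I|%:R * V ->
  #|[set f : {ffun J -> I} | 2 * tau < normc (\sum_j X j (f j))]%SET|%:R <=
    4 * #|I|%:R ^+ #|J| * expR (2 * th ^+ 2 * V - th * tau).
Proof.
move=> th0 X0 X2 XV.
pose Y b j i := complex.Re (direction b * X j i).
have YX b j i : `|Y b j i| <= normc (X j i).
  by rewrite (le_trans (ler_Re_normc _))// normcM normc_direction mul1r.
have -> : 4 * #|I|%:R ^+ #|J| * expR (2 * th ^+ 2 * V - th * tau) =
    \sum_(b : bool * bool) (#|I|%:R ^+ #|J| * expR (2 * th ^+ 2 * V - th * tau)).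
  by rewrite sumr_const card_prod card_bool -[RHS]mulr_natl mulrA.
apply: (@le_trans _ _ (\sum_b #|[set f : {ffun J -> I} |
    (tau <= \sum_j Y b j (f j))%R]%SET|)%N%:R); last first.
  rewrite natr_sum ler_sum// => b _; apply: card_sum_tail => //.
  - by move=> j; rewrite -Re_sum -mulr_sumr X0 mulr0.
  - move=> j i; apply: le_trans (X2 j i); rewrite ler_wpM2l//.
    exact: le_trans (ler_norm _) (YX _ _ _).
  - apply: le_trans XV; apply: ler_sum => j _; apply: ler_sum => i _.
    rewrite -[Y b j i ^+ 2]real_normK ?num_real//.
    by rewrite ler_sqr ?nnegrE ?normc_ge0 ?normr_ge0.
rewrite ler_nat; apply: leq_trans (leq_card_exists _).
apply/subset_leq_card/fintype.subsetP => f; rewrite !inE => hf.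
apply: contraLR hf => /existsPn hf; rewrite -leNgt.
apply: normc_le_directions => b; have := hf b.
by rewrite -ltNge mulr_sumr Re_sum => /ltW.
Qed.

End tail.

Section concatenation.
Variables (I : finType) (m n : nat).

Definition cat_ffun (f : {ffun 'I_m -> I}) (g : {ffun 'I_n -> I}) :
    {ffun 'I_(m + n) -> I} :=
  [ffun r => match fintype.split r with inl i => f i | inr i => g i end].

Lemma cat_ffunl f g i : cat_ffun f g (lshift n i) = f i.
Proof. by rewrite ffunE (unsplitK (inl i)). Qed.

Lemma cat_ffunr f g i : cat_ffun f g (rshift m i) = g i.
Proof. by rewrite ffunE (unsplitK (inr i)). Qed.

(** Fubini for counts: with the first draws [f] fixed, the later draws [g] remain free. This plays
    the role of conditioning on the first batch. *)
Lemma card_cat_ffun (P : pred {ffun 'I_(m + n) -> I}) :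
  #|[set f | P f]%SET| =
  (\sum_(f : {ffun 'I_m -> I}) #|[set g | P (cat_ffun f g)]%SET|)%N.
Proof.
under eq_bigr do rewrite -sum1_card.
rewrite pair_big_dep/= -sum1_card.
rewrite (reindex (fun p => cat_ffun p.1 p.2))/=.
  by apply: eq_bigl => -[f g] /=; rewrite !inE.
exists (fun f => ([ffun i => f (lshift n i)], [ffun i => f (rshift m i)])).
  by move=> [f g] _; congr pair; apply/ffunP => i; rewrite ffunE ?cat_ffunl ?cat_ffunr.
move=> f _; apply/ffunP => r; rewrite -(splitK r).
by case: (fintype.split r) => i /=; rewrite ?cat_ffunl ?cat_ffunr ffunE.
Qed.

End concatenation.
End counting.

(** * One golfing step *)

Section golfing.
Context {R : realType} (N : nat).
Local Notation C := R[i].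
Local Notation normc := (@ComplexField.Normc.normc R).
Variables (U : 'M[C]_N) (S : {set 'I_N}) (mu Q : R).
Hypothesis N_gt0 : (0 < N)%N.
Hypothesis U_orthonormal : forall j k, \sum_i U i j * (U i k)^* = (j == k)%:R.
Hypothesis U_bounded : forall i j, normc (U i j) <= mu.
Hypothesis Q_ge1 : 1 <= Q.
Hypothesis Q_large : N%:R * mu ^+ 2 * #|S|%:R <= Q.

Let row_product (w : 'I_N -> C) (i : 'I_N) : C := \sum_k (U i k)^* * w k.

Lemma sum_row_product w j : \sum_i U i j * row_product w i = w j.
Proof.
under eq_bigr do rewrite mulr_sumr.
rewrite exchange_big/=.
under eq_bigr do under eq_bigr do rewrite mulrA.
under eq_bigr do rewrite -mulr_suml U_orthonormal.
rewrite (bigD1 j)//= eqxx mul1r big1 ?addr0// => k.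
by rewrite eq_sym => /negbTE->; rewrite mul0r.
Qed.

Lemma parseval w : \sum_i normc (row_product w i) ^+ 2 = \sum_k normc (w k) ^+ 2.
Proof.
apply: complexI; rewrite !rmorph_sum/=.
under eq_bigr do rewrite normc_sqrE mulrC {1}/row_product rmorph_sum/= mulr_suml.
rewrite exchange_big/=; apply: eq_bigr => k _.
rewrite normc_sqrE mulrC -[X in _ = _ * X](sum_row_product w k) mulr_sumr.
by apply: eq_bigr => i _; rewrite rmorphM/= conjCK; ring.
Qed.

Variables (w : 'I_N -> C) (a : R).
Hypothesis w_supp : forall j, j \notin S -> w j = 0.
Hypothesis w_bounded : forall j, normc (w j) <= a.

Let a_ge0 : 0 <= a.
Proof. exact: le_trans (normc_ge0 (w (Ordinal N_gt0))) (w_bounded _). Qed.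

Let mu_ge0 : 0 <= mu.
Proof.
exact: le_trans (normc_ge0 _) (U_bounded (Ordinal N_gt0) (Ordinal N_gt0)).
Qed.

(** For [i] uniform its mean is [w j], by orthonormality of the columns: averaged over a batch, it
    is an unbiased estimate of the target built from the sampled rows. *)
Definition golf_row j i : C := N%:R * (U i j * row_product w i).

Lemma normcn (n : nat) : normc n%:R = n%:R.
Proof. by rewrite -(rmorph_nat (@real_complex R)) normcR normr_nat. Qed.

Lemma normc_row_product i : normc (row_product w i) <= mu * (#|S|%:R * a).
Proof.
rewrite /row_product (bigID (mem S))/= [X in _ + X]big1 ?addr0; last first.
  by move=> k /w_supp->; rewrite mulr0.
rewrite (le_trans (ler_normc_sum _ _ _))// mulrCA mulr_natl -sumr_const.
rewrite ler_sum// => k _; rewrite normcM normcJ.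
by rewrite ler_pM// normc_ge0.
Qed.

Lemma normc_golf_row j i : normc (golf_row j i) <= Q * a.
Proof.
rewrite !normcM normcn.
have : normc (U i j) * normc (row_product w i) <= mu * (mu * (#|S|%:R * a)).
  by rewrite ler_pM ?normc_ge0 ?normc_row_product.
move=> /(ler_wpM2l (ler0n R N)) /le_trans; apply.
have := ler_wpM2r a_ge0 Q_large; apply: le_trans.
by rewrite expr2 !mulrA.
Qed.

Lemma sum_golf_row j : \sum_i (golf_row j i - w j) = 0.
Proof.
rewrite big_split/= -mulr_sumr sum_row_product sumr_const card_ord.
by rewrite mulNrn mulr_natl subrr.
Qed.

Lemma normc_golf_row_dev j i : normc (golf_row j i - w j) <= 2 * Q * a.
Proof.
rewrite (le_trans (ler_normcB _ _))//.
have := normc_golf_row j i; have := w_bounded j.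
have := ler_wpM2r a_ge0 Q_ge1; lra.
Qed.

(** Only the entry [U i j] is bounded by [mu]; the coefficients of [w] are summed exactly by
    Parseval. The second moment is thus linear in [Q], whereas squaring the uniform bound would give
    Q^2, and a batch of order Q log N is enough. *)
Lemma sum_normc_golf_row_dev j :
  \sum_i normc (golf_row j i - w j) ^+ 2 <= N%:R * (4 * Q * a ^+ 2).
Proof.
have sq i : normc (golf_row j i - w j) ^+ 2 <=
    2 * (N%:R * mu) ^+ 2 * normc (row_product w i) ^+ 2 + 2 * a ^+ 2.
  have : normc (golf_row j i - w j) <= N%:R * mu * normc (row_product w i) + a.
    rewrite (le_trans (ler_normcB _ _))// lerD// !normcM normcn -mulrA.
    by rewrite ler_wpM2l// ler_wpM2r// normc_ge0.
  move=> /(lerXn2r 2); rewrite !nnegrE normc_ge0 addr_ge0 ?mulr_ge0 ?normc_ge0//.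
  move=> /(_ isT isT) /le_trans; apply; set x := _ * normc _.
  have -> : 2 * (N%:R * mu) ^+ 2 * normc (row_product w i) ^+ 2 = 2 * x ^+ 2.
    by rewrite /x; ring.
  by have := sqr_ge0 (x - a); nra.
apply: (le_trans (ler_sum _ (fun i _ => sq i))).
rewrite big_split/= -mulr_sumr parseval sumr_const card_ord -[X in _ + X <= _]mulr_natl.
have : \sum_k normc (w k) ^+ 2 <= #|S|%:R * a ^+ 2.
  rewrite (bigID (mem S))/= [X in _ + X]big1 ?addr0; last first.
    by move=> k /w_supp->; rewrite normc0 expr0n.
  rewrite mulr_natl -sumr_const ler_sum// => k _.
  by rewrite ler_sqr ?nnegrE ?normc_ge0.
have c0 : 0 <= 2 * (N%:R * mu) ^+ 2 by rewrite mulr_ge0 ?sqr_ge0.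
move=> /(ler_wpM2l c0).
have Na0 : 0 <= N%:R * a ^+ 2 by rewrite mulr_ge0 ?sqr_ge0.
have := ler_wpM2l Na0 Q_large; have := ler_wpM2l Na0 Q_ge1.
rewrite !exprMn; set n := N%:R; set c := #|S|%:R; set s := \sum_k _.
have -> : n * a ^+ 2 * (n * mu ^+ 2 * c) = n ^+ 2 * mu ^+ 2 * (c * a ^+ 2) by ring.
by lra.
Qed.

Lemma card_golf_step (m' : nat) : (0 < m')%N -> 0 < a ->
  #|[set f : {ffun 'I_m' -> 'I_N} | [exists j,
     a / 4 < normc (m'%:R^-1 * (\sum_r golf_row j (f r)) - w j)]]%SET|%:R <=
  4 * N%:R * expR (- (m'%:R / (2048 * Q))) * N%:R ^+ m'.
Proof.
move=> m0 a0; have Q0 : 0 < Q := lt_le_trans ltr01 Q_ge1.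
have mR0 : 0 < m'%:R :> R by rewrite ltr0n.
have step j : #|[set f : {ffun 'I_m' -> 'I_N} |
     a / 4 < normc (m'%:R^-1 * (\sum_r golf_row j (f r)) - w j)]%SET|%:R <=
   4 * N%:R ^+ m' * expR (- (m'%:R / (2048 * Q))).
  have -> : [set f : {ffun 'I_m' -> 'I_N} |
     a / 4 < normc (m'%:R^-1 * (\sum_r golf_row j (f r)) - w j)]%SET =
     [set f : {ffun 'I_m' -> 'I_N} | 2 * (m'%:R * a / 8) <
       normc (\sum_r (golf_row j (f r) - w j))]%SET.
    apply/setP => f; rewrite !inE big_split/= sumr_const card_ord mulNrn.
    have -> : \sum_r golf_row j (f r) - w j *+ m' =
      m'%:R * (m'%:R^-1 * (\sum_r golf_row j (f r)) - w j).
      rewrite mulrBr mulrA divff ?mul1r ?mulr_natl//.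
      by rewrite pnatr_eq0 -lt0n.
    rewrite [in RHS]normcM normcn.
    have -> : 2 * (m'%:R * a / 8) = m'%:R * (a / 4) by field.
    by rewrite ltr_pM2l.
  (* The deviation 2 * tau is m' * a / 4, and [th] = tau / (4 V) minimizes the exponent 2 th^2 V -
     th tau, leaving - m' / (2048 Q). *)
  have := @card_normc_sum_tail R 'I_N 'I_m' _ (fun _ i => golf_row j i - w j)
    (128 * Q * a)^-1 (m'%:R * a / 8) (m'%:R * (4 * Q * a ^+ 2)).
  rewrite !card_ord; have -> : 2 * (128 * Q * a)^-1 ^+ 2 * (m'%:R * (4 * Q * a ^+ 2)) -
    (128 * Q * a)^-1 * (m'%:R * a / 8) = - (m'%:R / (2048 * Q)).
    by field; rewrite !gt_eqF.
  apply => //.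
  - by rewrite invr_ge0 !mulr_ge0// ltW.
  - by move=> _; exact: sum_golf_row.
  - move=> _ i; rewrite mulrC ler_pdivrMr ?mulr_gt0//.
    have := normc_golf_row_dev j i.
    have : 0 < Q * a by rewrite mulr_gt0.
    by rewrite -!mulrA; lra.
  - rewrite sumr_const card_ord -[leLHS]mulr_natl mulrCA ler_wpM2l//.
    exact: sum_normc_golf_row_dev.
apply: (@le_trans _ _ (\sum_j #|[set f : {ffun 'I_m' -> 'I_N} |
     (a / 4 < normc (m'%:R^-1 * (\sum_r golf_row j (f r)) - w j))%R]%SET|)%N%:R).
  by rewrite ler_nat leq_card_exists.
rewrite natr_sum (le_trans (ler_sum _ (fun j _ => step j)))//.
by rewrite sumr_const card_ord -[leLHS]mulr_natl; rewrite le_eqVlt; apply/orP; left; apply/eqP; ring.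
Qed.

End golfing.

(** * Iterating the golfing step *)

Section golfing_scheme.
Context {R : realType} (N : nat).
Local Notation C := R[i].
Local Notation normc := (@ComplexField.Normc.normc R).
Variables (U : 'M[C]_N) (S : {set 'I_N}) (mu Q : R) (m' : nat).
Hypothesis N_gt0 : (0 < N)%N.
Hypothesis U_orthonormal : forall j k, \sum_i U i j * (U i k)^* = (j == k)%:R.
Hypothesis U_bounded : forall i j, normc (U i j) <= mu.
Hypothesis Q_ge1 : 1 <= Q.
Hypothesis Q_large : N%:R * mu ^+ 2 * #|S|%:R <= Q.
Hypothesis m'_gt0 : (0 < m')%N.

Definition no_certificate m w a b : pred {ffun 'I_m -> 'I_N} :=
  fun f => ~~ `[< dual_certificate U [set f r | r : 'I_m]%SET S w a b >].

(** On [S] the later batches aim at the residual, so their error is the total error. Off [S] the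
    contributions add up: a/4 from the first batch and a third of a/4 from the others, that is a/3
    again. The new target is cut off outside [S], so the scheme can be iterated. *)
Lemma golf_certificate n w a b (f : {ffun 'I_m' -> 'I_N}) (g : {ffun 'I_n -> 'I_N}) :
  let v j := m'%:R^-1 * \sum_r golf_row U w j (f r) in
  (forall j, j \notin S -> w j = 0) ->
  (forall j, normc (v j - w j) <= a / 4) ->
  dual_certificate U [set g r | r : 'I_n]%SET S
     (fun j => if j \in S then w j - v j else 0) b (a / 12) ->
  dual_certificate U [set cat_ffun f g r | r : 'I_(m' + n)]%SET S w b (a / 3).
Proof.
move=> v w0 vw [y [y0 yS]].
(* A row may be drawn several times: its coefficient gathers all the draws equal to [i]. *)
pose x i := m'%:R^-1 * (N%:R * \sum_(r | f r == i) (\sum_k (U i k)^* * w k)).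
have xv j : \sum_i x i * U i j = v j.
  rewrite /v /golf_row (partition_big f predT)//= mulr_sumr.
  apply: eq_bigr => i _; rewrite /x -!mulrA; congr (_ * _).
  rewrite mulrA mulr_sumr mulr_suml; apply: eq_bigr => r /eqP->.
  by rewrite [in RHS](mulrC (U _ _)) mulrA.
exists (fun i => x i + y i); split.
  move=> i iD; rewrite y0 ?addr0; last first.
    apply: contra iD => /imsetP[r _ ->]; apply/imsetP; exists (rshift m' r) => //.
    by rewrite cat_ffunr.
  rewrite /x big_pred0 ?mulr0// => r; apply: contraNF iD => /eqP <-.
  by apply/imsetP; exists (lshift n r); rewrite ?cat_ffunl.
move=> j; have -> : \sum_i (x i + y i) * U i j = v j + \sum_i y i * U i j.
  by rewrite -xv -big_split/=; apply: eq_bigr => i _; rewrite mulrDl.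
have /= := yS j; case: ifPn => jS.
  by rewrite jS opprB addrA [X in normc (X - _)]addrC.
move=> h; rewrite (le_trans (ler_normcD _ _))//.
by have := vw j; rewrite w0// subr0; lra.
Qed.

(** Induction on the number of batches, the failure proportions adding up. The next target depends
    on the first batch, but with that batch fixed the induction hypothesis holds uniformly in the
    target. Draws left over after [L] batches receive coefficient 0. *)
Lemma card_no_certificate L m w a : 0 < a -> (L * m' <= m)%N ->
  (forall j, j \notin S -> w j = 0) -> (forall j, normc (w j) <= a) ->
  #|[set f | no_certificate w (a / 4 ^+ L) (a / 3) f]%SET : {set {ffun 'I_m -> 'I_N}}|%:R <=
    L%:R * (4 * N%:R * expR (- (m'%:R / (2048 * Q)))) * N%:R ^+ m.
Proof.
set eta := 4 * _ * _.
have eta0 : 0 <= eta by rewrite /eta mulr_ge0 ?expR_ge0 ?mulr_ge0.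
(* Without batches the zero combination has error at most [a] on [S] and 0 elsewhere. *)
elim: L m w a => [|L IH] m w a a0 mL w0 wa.
  rewrite !mul0r (eq_card0 (A := [set f | _]%SET))// => f.
  rewrite inE; apply/negbTE; rewrite negbK; apply/asboolP.
  exists (fun=> 0); split=> // j; rewrite big1 => [|i _]; last by rewrite mul0r.
  by case: ifP => _; rewrite ?normc0 ?sub0r ?normcN ?expr0 ?divr1// divr_ge0// ltW.
have -> : m = (m' + (m - m'))%N.
  by rewrite subnKC// (leq_trans _ mL)// mulSn leq_addr.
have {mL} : (L * m' <= m - m')%N by rewrite leq_subRL ?(leq_trans _ mL)// mulSn ?leq_addr.
move: (m - m')%N => n {m} mL.
rewrite card_cat_ffun.
pose v (f : {ffun 'I_m' -> 'I_N}) j := m'%:R^-1 * \sum_r golf_row U w j (f r).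
pose bad := [set f : {ffun 'I_m' -> 'I_N} | [exists j, a / 4 < normc (v f j - w j)]]%SET.
have badE : #|bad|%:R <= eta * N%:R ^+ m'.
  exact: (card_golf_step N_gt0 U_orthonormal U_bounded Q_ge1 Q_large).
rewrite natr_sum (bigID (mem bad))/=.
have -> : L.+1%:R * eta * N%:R ^+ (m' + n) =
   eta * N%:R ^+ m' * N%:R ^+ n + N%:R ^+ m' * (L%:R * eta * N%:R ^+ n).
  by rewrite -natr1 exprD; ring.
(* After a bad first batch every continuation is counted as failing. *)
apply: lerD.
  apply: (@le_trans _ _ (\sum_(f in bad) N%:R ^+ n)).
    apply: ler_sum => f _; rewrite -[leRHS]natrX ler_nat.
    by rewrite (leq_trans (max_card _))// card_ffun !card_ord.
  by rewrite sumr_const -[leLHS]mulr_natl ler_wpM2r// exprn_ge0.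
apply: (@le_trans _ _ (\sum_(f : {ffun 'I_m' -> 'I_N}) L%:R * eta * N%:R ^+ n)); last first.
  by rewrite sumr_const card_ffun !card_ord -[leLHS]mulr_natl natrX.
rewrite [leRHS](bigID (mem bad))/= ler_wpDl//.
  by apply: sumr_ge0 => f _; rewrite mulr_ge0 ?exprn_ge0// mulr_ge0.
apply: ler_sum => f; rewrite inE => /existsPn fgood.
have vw j : normc (v f j - w j) <= a / 4 by rewrite leNgt.
have a4 : 0 < a / 4 by rewrite divr_gt0.
apply: le_trans (IH n (fun j => if j \in S then w j - v f j else 0) (a / 4) a4 mL _ _).
- rewrite ler_nat; apply/subset_leq_card/fintype.subsetP => g; rewrite !inE.
  apply: contra => /asboolP h; apply/asboolP; apply: golf_certificate => //.
  by move: h; rewrite exprS invfM mulrA -(mulrA a) -invfM; congr (dual_certificate _ _ _ _ _ _); field.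
- by move=> j /negbTE->.
- move=> j; case: ifP => _; last by rewrite normc0 ltW.
  by rewrite -normcN opprB.
Qed.

End golfing_scheme.

(** * Coherence and the entries of the modulated matrix *)

Section coherence.
Context {R : realType} (N : nat).
Local Notation C := R[i].
Local Notation normc := (@ComplexField.Normc.normc R).
Implicit Types (Phi Psi U : 'M[C]_N) (z c : 'I_N -> C).

Lemma unitarymx_colE U j k : U \is unitarymx ->
  \sum_i U i j * (U i k)^* = (j == k)%:R.
Proof.
rewrite -trmx_unitary => /unitarymxP/matrixP/(_ j k); rewrite !mxE => <-.
by apply: eq_bigr => i _; rewrite !mxE.
Qed.

Lemma sum_normc_col U j : U \is unitarymx -> \sum_i normc (U i j) ^+ 2 = 1.
Proof.
move=> Uu; apply: complexI; rewrite rmorph_sum/= rmorph1.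
by under eq_bigr do rewrite normc_sqrE; rewrite unitarymx_colE// eqxx.
Qed.

Lemma sum_normc_row U i : U \is unitarymx -> \sum_j normc (U i j) ^+ 2 = 1.
Proof.
rewrite -trmx_unitary => /sum_normc_col-/(_ i) <-.
by apply: eq_bigr => j _; rewrite mxE.
Qed.

Lemma modulus_coherence_ge0 Phi Psi : 0 <= modulus_coherence Phi Psi.
Proof.
by rewrite /modulus_coherence; elim/big_rec : _ => // i x _ x0; rewrite le_max x0 orbT.
Qed.

Lemma modulus_coherence_ge Phi Psi i j :
  \sum_k normc ((Phi k i)^* * Psi k j) ^+ 2 <= modulus_coherence Phi Psi ^+ 2.
Proof.
set x := \sum_k _; have x0 : 0 <= x by apply: sumr_ge0 => k _; exact: sqr_ge0.
rewrite -[leLHS]sqr_sqrtr// lerXn2r ?nnegrE ?sqrtr_ge0 ?modulus_coherence_ge0//.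
apply: le_trans (le_bigmax _ _ i); apply: le_trans (le_bigmax _ _ j).
exact: lexx.
Qed.

(** Summing the squared quantities over [i] for one column [j] gives 1, since the rows of Phi and
    the column of Psi are unit vectors, and each of the N terms is at most the squared coherence. *)
Lemma modulus_coherence_sqr_ge Phi Psi : (0 < N)%N ->
  Phi \is unitarymx -> Psi \is unitarymx ->
  1 <= N%:R * modulus_coherence Phi Psi ^+ 2.
Proof.
move=> N0 Phiu Psiu; pose j := Ordinal N0.
rewrite -[leLHS](sum_normc_col j Psiu) -[X in X%:R]card_ord mulr_natl -sumr_const.
apply: le_trans (ler_sum _ (fun i _ => modulus_coherence_ge Phi Psi i j)).
rewrite exchange_big/= ler_sum// => k _.
under eq_bigr do rewrite normcM normcJ exprMn.
by rewrite -mulr_suml sum_normc_row// mul1r.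
Qed.

Lemma modulatedE Phi Psi c i j :
  modulated Phi Psi c i j = \sum_k (Phi k i)^* * Psi k j * c k.
Proof.
rewrite /modulated mxE; apply: eq_bigr => k _.
rewrite mul_mx_diag !mxE; ring.
Qed.

Lemma modulated_unitary Phi Psi c : Phi \is unitarymx -> Psi \is unitarymx ->
  (forall k, normc (c k) = 1) -> modulated Phi Psi c \is unitarymx.
Proof.
move=> Phiu Psiu c1; rewrite !mul_unitarymx ?trmxC_unitary//.
apply/unitarymxP/matrixP => i j; rewrite mul_diag_mx !mxE.
have [->|ij] := eqVneq j i.
  by rewrite mulr1n -normc_sqrE c1 expr1n.
by rewrite !mulr0n conjC0 mulr0.
Qed.

Definition signed z (e : {ffun 'I_N -> bool}) : 'I_N -> C :=
  fun k => (-1) ^+ e k * z k.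

Lemma normc_signed z e k : normc (signed z e k) = normc (z k).
Proof.
rewrite normcM; case: (e k); rewrite ?expr0 ?expr1 ?normcN normc1 mul1r//.
Qed.

(** An entry is a sum of random signs whose coefficients have squared moduli adding up to at most
    the squared coherence, which serves as the variance. *)
Lemma card_incoherent Phi Psi z (t : R) : (0 < N)%N ->
  Phi \is unitarymx -> Psi \is unitarymx -> (forall k, normc (z k) = 1) ->
  #|[set e : {ffun 'I_N -> bool} | [exists p : 'I_N * 'I_N,
     2 * (t * modulus_coherence Phi Psi) <
       normc (modulated Phi Psi (signed z e) p.1 p.2)]]%SET|%:R <=
  N%:R ^+ 2 * (4 * 2 ^+ N * expR (2^-1 - t / 2)).
Proof.
move=> N0 Phiu Psiu z1.
set beta := modulus_coherence Phi Psi.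
have b0 : 0 < beta.
  rewrite lt_neqAle modulus_coherence_ge0 andbT eq_sym; apply/negP => /eqP b0.
  by have := modulus_coherence_sqr_ge N0 Phiu Psiu; rewrite -/beta b0 expr0n mulr0 ler10.
apply: (@le_trans _ _ (\sum_p #|[set e : {ffun 'I_N -> bool} |
     (2 * (t * beta) < normc (modulated Phi Psi (signed z e) p.1 p.2))%R]%SET|)%N%:R).
  by rewrite ler_nat leq_card_exists.
rewrite natr_sum; apply: (@le_trans _ _
    (\sum_(p : 'I_N * 'I_N) (4 * 2 ^+ N * expR (2^-1 - t / 2)))); last first.
  by rewrite sumr_const card_prod card_ord -[leLHS]mulr_natl natrM -expr2.
apply: ler_sum => -[i j] _ /=.
pose X (k : 'I_N) (b : bool) : C := (Phi k i)^* * Psi k j * ((-1) ^+ b * z k).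
have normX k b : normc (X k b) = normc ((Phi k i)^* * Psi k j).
  rewrite normcM [X in _ * X]normcM z1 mulr1.
  by case: b; rewrite ?expr0 ?expr1 ?normcN normc1 mulr1.
have I0 : (0 < #|{: bool}|)%N by rewrite card_bool.
(* Each coefficient has modulus at most beta, so [th] = 1 / (2 beta) is admissible; the exponent is
   then linear in [t], which costs a full logarithm for the entries. *)
have := @card_normc_sum_tail R bool 'I_N I0 X (2 * beta)^-1 (t * beta) (beta ^+ 2).
have -> : 2 * (2 * beta)^-1 ^+ 2 * beta ^+ 2 - (2 * beta)^-1 * (t * beta) =
    2^-1 - t / 2 by field; rewrite gt_eqF.
rewrite card_bool card_ord => h; rewrite (le_trans _ (h _ _ _ _))//.
- rewrite ler_nat; apply/subset_leq_card/fintype.subsetP => e.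
  by rewrite !inE modulatedE.
- by rewrite invr_ge0 mulr_ge0 ?ltW.
- by move=> k; rewrite big_bool/= /X; ring.
- move=> k b; rewrite normX mulrC ler_pdivrMr ?mulr_gt0// mulrA mulVf// mul1r.
  rewrite -ler_sqr ?nnegrE ?normc_ge0 ?(ltW b0)//.
  apply: le_trans (modulus_coherence_ge Phi Psi i j).
  by rewrite (bigD1 k)//= lerDl sumr_ge0// => ? _; exact: sqr_ge0.
- under eq_bigr do under eq_bigr do rewrite normX.
  under eq_bigr do rewrite sumr_const card_bool -mulr_natl.
  by rewrite -mulr_sumr ler_wpM2l// modulus_coherence_ge.
Qed.

End coherence.

(** * Failing rows for a matrix with small entries *)

Section failure_count.
Context {R : realType} (N : nat).
Local Notation C := R[i].
Local Notation normc := (@ComplexField.Normc.normc R).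

Definition recovers m (Phi Psi : 'M[C]_N) (alpha : 'cV[C]_N) (c : 'I_N -> C)
    (lam : 'I_m -> 'I_N) : Prop :=
  let A := rowsub lam (modulated Phi Psi c) in
  unique_l1_minimizer A (A *m alpha) alpha.

(** Union bound over N + 1 targets. The condition 2 N <= 4^L makes the error 4^-L, multiplied by |S|
    <= N, at most 1/2, as recovery from certificates demands. *)
Lemma card_no_recovery m m' L (U : 'M[C]_N) (alpha : 'cV[C]_N) (mu Q : R) :
  (0 < N)%N -> (0 < m')%N -> U \is unitarymx ->
  (forall i j, normc (U i j) <= mu) -> 1 <= Q ->
  N%:R * mu ^+ 2 * #|[set i | (alpha i 0 != 0)%R]%SET|%:R <= Q ->
  (L * m' <= m)%N -> (2 * N <= 4 ^ L)%N ->
  #|[set f : {ffun 'I_m -> 'I_N} |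
      ~~ `[< unique_l1_minimizer (rowsub f U) (rowsub f U *m alpha) alpha >]]%SET|%:R <=
   (N.+1 * L)%:R * (4 * N%:R * expR (- (m'%:R / (2048 * Q)))) * N%:R ^+ m.
Proof.
move=> N0 m'0 Uu Umu Q1 QS mL NL.
set S := [set i | _]%SET in QS *; set eta := 4 * _ * _.
(* [None] stands for the sign of alpha, [Some k] for a basis vector; for [k] outside [S] the target
   is zero, so that all targets are supported on [S]. *)
pose w (o : option 'I_N) j : C := if o is Some k then ((k \in S) && (j == k))%:R
                              else conj_sign (alpha j 0).
have w0 o j : j \notin S -> w o j = 0.
  rewrite inE negbK => /eqP aj0; case: o => [k|]/=; last first.
    by rewrite /conj_sign aj0 conjC0 mul0r.
  case: eqP => [<-|]; last by rewrite andbF.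
  by rewrite inE aj0 eqxx.
have w1 o j : normc (w o j) <= 1.
  case: o => [k|]/=; first by case: (_ && _); rewrite ?normc1 ?normc0.
  have [->|a0] := eqVneq (alpha j 0) 0; last by rewrite normc_conj_sign.
  by rewrite /conj_sign conjC0 mul0r normc0.
apply: (@le_trans _ _ (\sum_o #|[set f : {ffun 'I_m -> 'I_N} |
    no_certificate U S (w o) (1 / 4 ^+ L) (1 / 3) f]%SET|)%N%:R).
  rewrite ler_nat; apply: leq_trans (leq_card_exists _).
  apply/subset_leq_card/fintype.subsetP => f; rewrite !inE.
  apply: contraLR => /existsPn hf; rewrite negbK; apply/asboolP.
  have cert o : dual_certificate U [set f r | r : 'I_m]%SET S (w o)
      (1 / 4 ^+ L) 3^-1.
    by rewrite -[3^-1]div1r; have := hf o; rewrite negbK => /asboolP.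
  apply: (certificates_recovery (D := [set f r | r : 'I_m]%SET) (S := S)
    (a := 1 / 4 ^+ L)) => //.
  - by move=> i /imsetP[r _ ->]; exists r.
  - rewrite mulrAC mul1r ler_pdivrMr ?exprn_gt0// mulrC ler_pdivlMr//.
    rewrite -natrX -natrM ler_nat mulnC (leq_trans _ NL)// leq_mul2l/=.
    by rewrite -[X in (_ <= X)%N]card_ord max_card.
  - exact: (cert None).
  - move=> k kS; have [y [y0 yS]] := cert (Some k); exists y; split=> // j.
    by have := yS j; rewrite /w kS.
rewrite natr_sum.
apply: (@le_trans _ _ (\sum_(o : option 'I_N) L%:R * eta * N%:R ^+ m)).
  apply: ler_sum => o _; apply: (card_no_certificate N0 _ Umu Q1 QS m'0 ltr01 mL (w0 o) (w1 o)).
  by move=> j k; exact: unitarymx_colE.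
by rewrite sumr_const card_option card_ord -[leLHS]mulr_natl natrM !mulrA.
Qed.

End failure_count.

(** * Choice of the constants and count of failing pairs *)

Section failure_total.
Context {R : realType} (N : nat).
Local Notation C := R[i].
Local Notation normc := (@ComplexField.Normc.normc R).
Hypothesis N_ge2 : (2 <= N)%N.
Let ell : R := ln N%:R.

Lemma ln2_ge_half : 2^-1 <= ln 2 :> R.
Proof.
rewrite -ler_expR lnK ?posrE//.
by apply: (le_trans (expR_le_quadratic (lexx _))); lra.
Qed.

Let N_gt0 : (0 < N)%N. Proof. exact: leq_trans N_ge2. Qed.

Let NR_gt0 : 0 < N%:R :> R. Proof. by rewrite ltr0n. Qed.

Let expR_ell : expR ell = N%:R.
Proof. by rewrite /ell lnK ?posrE. Qed.

Let ell_ge_half : 2^-1 <= ell.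
Proof.
by rewrite (le_trans ln2_ge_half)// /ell ler_ln ?posrE// (ler_nat R 2 N).
Qed.

Let ell_gt0 : 0 < ell. Proof. by apply: lt_le_trans ell_ge_half; lra. Qed.

(** Since ln 2 >= 1/2, the binary logarithm is at most 2 [ell], and the added 1 is also at most 2
    [ell]. *)
Lemma trunc_log_le_ln : (trunc_log 2 N).+1%:R <= 4 * ell.
Proof.
have : (2 ^ trunc_log 2 N)%:R <= N%:R :> R by rewrite ler_nat trunc_logP.
rewrite natrX -ler_ln ?posrE ?exprn_gt0// lnXn// -/ell -[leLHS]mulr_natl => h.
have : (trunc_log 2 N)%:R * 2^-1 <= (trunc_log 2 N)%:R * ln 2 :> R.
  by rewrite ler_wpM2l// ln2_ge_half.
by move=> h2; rewrite -[leLHS]natr1; have := ell_ge_half; lra.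
Qed.

Lemma two_le_exp4_trunc_log : (2 * N <= 4 ^ (trunc_log 2 N).+1)%N.
Proof.
have := trunc_log_ltn N (isT : (1 < 2)%N).
move: (trunc_log 2 N).+1 => k h.
have -> : (4 ^ k = 2 ^ k * 2 ^ k)%N by rewrite -expnMn.
by apply: leq_mul; [exact: leq_trans N_ge2 (ltnW h)|exact: ltnW].
Qed.

Lemma trunc_log_le : ((trunc_log 2 N).+1 <= N)%N.
Proof. by rewrite (leq_trans (ltn_expl _ (isT : (1 < 2)%N)))// trunc_logP. Qed.

(** The constant is 8 and not 4 so that 2 X <= q + 1 for the quotient [q]; with X >= 1 this absorbs
    the rounding. *)
Lemma batch_size (m L : nat) (X : R) : (0 < L)%N -> L%:R <= 4 * ell -> 1 <= X ->
  8 * ell * X <= m%:R -> X <= (m %/ L)%:R.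
Proof.
move=> L0 Lell X1 mX; have LR0 : 0 < L%:R :> R by rewrite ltr0n.
have : m%:R <= ((m %/ L)%:R + 1) * L%:R :> R.
  by rewrite natr1 -natrM ler_nat ltnW// ltn_ceil.
set q := (m %/ L)%:R => mq.
have : (q + 1) * L%:R <= (q + 1) * (4 * ell) by rewrite ler_wpM2l// addr_ge0.
move=> /(le_trans mq)/(le_trans mX).
have -> : 8 * ell * X = (2 * X) * (4 * ell) by ring.
by rewrite ler_pM2r ?mulr_gt0//; lra.
Qed.

Lemma card_failures (rho : R) (m s : nat) (Phi Psi : 'M[C]_N)
    (alpha : 'cV[C]_N) (z : 'I_N -> C) : 0 < rho ->
  Phi \is unitarymx -> Psi \is unitarymx -> (forall k, normc (z k) = 1) ->
  (1 <= s)%N -> sparse s alpha ->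
  2 ^+ 19 * (rho + 3) ^+ 3 * N%:R * modulus_coherence Phi Psi ^+ 2 * s%:R *
    ell ^+ 5 <= m%:R ->
  (\sum_(e : {ffun 'I_N -> bool}) #|[set f : {ffun 'I_m -> 'I_N} |
     ~~ `[< recovers Phi Psi alpha (signed z e) f >]]%SET|)%N%:R <=
  16 * N%:R `^ (- rho) * (2 ^+ N * N%:R ^+ m) :> R.
Proof.
move=> rho0 Phiu Psiu z1 s1 alphas mC.
set beta := modulus_coherence Phi Psi in mC *.
set S := [set i | (alpha i 0 != 0)%R]%SET.
pose B := N%:R * beta ^+ 2 * s%:R.
have b0 : 0 <= beta by exact: modulus_coherence_ge0.
have B1 : 1 <= B.
  rewrite /B -[leLHS]mulr1 ler_pM ?modulus_coherence_sqr_ge//.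
  by rewrite (ler_nat R 1 s).
have B0 : 0 <= B by exact: le_trans B1.
have ell0 : 0 <= ell by exact: ltW.
have r2 : 0 <= rho + 2 by rewrite addr_ge0// ltW.
have r3 : 0 <= rho + 3 by rewrite addr_ge0// ltW.
have powE : N%:R `^ (- rho) = expR (- (rho * ell)).
  by rewrite /powR gt_eqF// mulNr.
(* Chosen so that the tail for one entry is of order N^(-rho-2), to be summed over N^2 entries. *)
pose t := 2 * (rho + 2) * ell.
pose mu := 2 * (t * beta).
pose Q := 16 * (rho + 2) ^+ 2 * ell ^+ 2 * B.
have QB : N%:R * mu ^+ 2 * s%:R = Q by rewrite /Q /mu /t /B; ring.
have r2ell : 1 <= (rho + 2) * ell.
  have : 2 * 2^-1 <= (rho + 2) * ell by apply: ler_pM => //; lra.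
  by lra.
have Q1 : 1 <= Q.
  have -> : Q = 16 * ((rho + 2) * ell) ^+ 2 * B by rewrite /Q; ring.
  have : 1 <= ((rho + 2) * ell) ^+ 2 by rewrite exprn_ege1.
  by move=> h; rewrite mulr_ege1//; lra.
have Q0 : 0 < Q by exact: lt_le_trans Q1.
have QS : N%:R * mu ^+ 2 * #|S|%:R <= Q.
  rewrite -QB ler_wpM2l ?ler_nat// mulr_ge0 ?sqr_ge0//.
set L := (trunc_log 2 N).+1; pose m' := (m %/ L)%N.
have m'big : 2048 * Q * ((rho + 3) * ell) <= m'%:R.
  apply: batch_size => //; first exact: trunc_log_le_ln.
    have : 1 <= (rho + 3) * ell by move: r2ell ell_gt0; lra.
    by move=> h; rewrite mulr_ege1//; lra.
  apply: le_trans mC.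
  (* Powers of [ell]: two from [Q] through the square of [mu], one from the union bound, one from
     the number of batches, one in 2 * ell >= 1. Powers of 2: 8 * 2048 * 16 = 2^18, and the 2 of 2 *
     ell. *)
  have -> : 2 ^+ 19 * (rho + 3) ^+ 3 * N%:R * beta ^+ 2 * s%:R * ell ^+ 5 =
     2 ^+ 18 * (rho + 3) ^+ 3 * B * ell ^+ 4 * (2 * ell) by rewrite /B; ring.
  have -> : 8 * ell * (2048 * Q * ((rho + 3) * ell)) =
     2 ^+ 18 * ((rho + 2) ^+ 2 * (rho + 3)) * B * ell ^+ 4 by rewrite /Q; ring.
  have e4 : 0 <= B * ell ^+ 4 by rewrite mulr_ge0 ?exprn_ge0.
  apply: (@le_trans _ _ (2 ^+ 18 * (rho + 3) ^+ 3 * B * ell ^+ 4)).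
    rewrite -2!(mulrA _ B) ler_wpM2r// ler_wpM2l ?exprn_ge0//.
    by rewrite [leRHS]exprSr ler_wpM2r// lerXn2r ?nnegrE// lerD2l ler_nat.
  apply: ler_peMr; last by move: ell_ge_half; lra.
  by rewrite -mulrA mulr_ge0// mulr_ge0 ?exprn_ge0.
clearbody Q.
have Q2048 : 0 < 2048 * Q by rewrite pmulr_rgt0 ?ltr0n.
have m'0 : (0 < m')%N.
  rewrite -(ltr0n R); apply: lt_le_trans m'big.
  have r3_gt0 : 0 < rho + 3 by rewrite addr_gt0.
  by rewrite pmulr_rgt0// pmulr_rgt0.
have mL : (L * m' <= m)%N by rewrite mulnC leq_divM.
pose bad := [set e : {ffun 'I_N -> bool} | [exists p : 'I_N * 'I_N,
     mu < normc (modulated Phi Psi (signed z e) p.1 p.2)]]%SET.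
have badE : #|bad|%:R <= 8 * N%:R `^ (- rho) * 2 ^+ N.
  apply: le_trans (card_incoherent t N_gt0 Phiu Psiu z1) _.
  have -> : 2^-1 - t / 2 = 2^-1 + - (rho * ell) + - (ell * 2) by rewrite /t; field.
  rewrite !expRD powE !expRN expRM_natr expR_ell.
  have h2 : expR 2^-1 <= 2 :> R.
    by apply: (le_trans (expR_le_quadratic (lexx _))); lra.
  set x := (expR (rho * ell))^-1; have x0 : 0 <= x by rewrite invr_ge0 expR_ge0.
  have -> : N%:R ^+ 2 * (4 * 2 ^+ N * (expR 2^-1 * x * (N%:R ^+ 2)^-1)) =
     4 * 2 ^+ N * x * expR 2^-1 by field; rewrite gt_eqF.
  have -> : 8 * x * 2 ^+ N = 4 * 2 ^+ N * x * 2 by ring.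
  by rewrite ler_wpM2l// mulr_ge0 ?mulr_ge0 ?exprn_ge0.
have goodE e : e \notin bad -> #|[set f : {ffun 'I_m -> 'I_N} |
     ~~ `[< recovers Phi Psi alpha (signed z e) f >]]%SET|%:R <=
     8 * N%:R `^ (- rho) * N%:R ^+ m :> R.
  rewrite inE => /existsPn good.
  have Uu : modulated Phi Psi (signed z e) \is unitarymx.
    by apply: modulated_unitary => // k; rewrite normc_signed.
  have Umu i j : normc (modulated Phi Psi (signed z e) i j) <= mu.
    by have := good (i, j); rewrite -leNgt.
  apply: le_trans (card_no_recovery N_gt0 m'0 Uu Umu Q1 QS mL two_le_exp4_trunc_log) _.
  rewrite ler_wpM2r ?exprn_ge0//.
  (* The spare N^-3 pays for N + 1 targets, L <= N batches and N coordinates. *)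
  have : expR (- (m'%:R / (2048 * Q))) <= N%:R `^ (- rho) * (N%:R ^+ 3)^-1.
    rewrite powE -expR_ell -expRM_natr -expRN -expRD ler_expR -opprD lerN2.
    rewrite ler_pdivlMr//; apply: le_trans m'big.
    by rewrite le_eqVlt; apply/orP; left; apply/eqP; ring.
  set x := N%:R `^ _; have x0 : 0 <= x by exact: powR_ge0.
  move=> h; have c0 : 0 <= (N.+1 * L)%:R * (4 * N%:R) :> R by rewrite mulr_ge0.
  rewrite mulrA (le_trans (ler_wpM2l c0 h))//.
  have : (N.+1 * L)%:R * (4 * N%:R) <= 8 * N%:R ^+ 3 :> R.
    have -> : 8 * N%:R ^+ 3 = (2 * N * N)%:R * (4 * N%:R) :> R.
      by rewrite !natrM; ring.
    rewrite ler_wpM2r ?mulr_ge0// ler_nat leq_mul ?trunc_log_le//.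
    by rewrite mul2n -addnn -addn1 leq_add2l.
  have y0 : 0 <= x * (N%:R ^+ 3)^-1 by rewrite mulr_ge0// invr_ge0 exprn_ge0.
  move=> /(ler_wpM2r y0)/le_trans; apply.
  by rewrite le_eqVlt; apply/orP; left; apply/eqP; field; rewrite gt_eqF.
rewrite natr_sum (bigID (mem bad))/=.
(* Half of the 16 is for the signs giving a large entry, whatever the rows; the other half is for
   failing rows under good signs. *)
have -> : 16 * N%:R `^ (- rho) * (2 ^+ N * N%:R ^+ m) =
   8 * N%:R `^ (- rho) * 2 ^+ N * N%:R ^+ m +
   2 ^+ N * (8 * N%:R `^ (- rho) * N%:R ^+ m) by ring.
apply: lerD.
  apply: (@le_trans _ _ (\sum_(f in bad) N%:R ^+ m)).
    apply: ler_sum => f _; rewrite -[leRHS]natrX ler_nat.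
    by rewrite (leq_trans (max_card _))// card_ffun !card_ord.
  by rewrite sumr_const -[leLHS]mulr_natl ler_wpM2r// exprn_ge0.
have c0 : 0 <= 8 * N%:R `^ (- rho) * N%:R ^+ m :> R.
  by rewrite mulr_ge0 ?exprn_ge0// mulr_ge0// powR_ge0.
apply: (@le_trans _ _ (\sum_(e : {ffun 'I_N -> bool}) 8 * N%:R `^ (- rho) * N%:R ^+ m)); last first.
  by rewrite sumr_const card_ffun card_bool card_ord -[leLHS]mulr_natl natrX.
rewrite [leRHS](bigID (mem bad))/= ler_wpDl ?sumr_ge0//.
by apply: ler_sum => e; exact: goodE.
Qed.

End failure_total.

(** * From real to rational witnesses *)

Section rational_sublevel.
Context {R : realType}.

(* Turns an uncountable union into countable operations, for measurability. *)
Lemma sublevel_rat n (G : 'rV[R]_n -> R) (M : R) : continuous G ->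
  (forall q, G q <= 1 -> forall i, `|q 0 i| <= M) ->
  (exists q, G q <= 0) <->
  (forall k : nat, exists q : 'rV[rat]_n, G (map_mx ratr q) <= k.+1%:R^-1).
Proof.
move=> Gcont GM; split=> [[q Gq0] k|Gq].
  have Gk : G q < k.+1%:R^-1 by rewrite (le_lt_trans Gq0)// invr_gt0.
  have : nbhs q [set x | G x < k.+1%:R^-1].
    exact: (cvgr_lt (G q) (Gcont q) _ Gk).
  move=> /nbhs_ballP[e /= e0 eG].
  have /choice[f fq] (i : 'I_n) : exists r : rat, ratr r \in `]q 0 i - e, q 0 i + e[.
    by apply: rat_in_itvoo; rewrite ltrD2l gt0_cp.
  exists (\row_i f i); apply/ltW/eG; split=> // i j; rewrite (ord1 i) !mxE.
  have := fq j; rewrite in_itv/= => /andP[h1 h2].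
  by rewrite /ball/= ltr_distlC h1.
(* This set is closed and bounded, so [G] attains its minimum on it; a positive minimum would exceed
   some 1/(k+1), against the rational points. *)
pose A := [set q | G q <= 1].
have A0 : A !=set0.
  by have [q] := Gq 0%N; rewrite invr1 => Gq1; exists (map_mx ratr q).
have Acompact : compact A.
  apply: (subclosed_compact _ (@rV_compact R n (fun=> `[- M, M]%classic) _)).
  - exact: (proj1 (continuous_closedP G) Gcont _ (@closed_le R 1)).
  - by move=> _; exact: segment_compact.
  - by move=> q Aq i /=; rewrite in_itv/= -ler_norml GM.
have [c _ cmin] := EVT_min_rV A0 Acompact (continuous_subspaceT Gcont).
exists c; rewrite leNgt; apply/negP => Gc0.
have [k] := ltr_add_invr Gc0; rewrite add0r => kGc.
have [q Gqk] := Gq k.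
have : G c <= G (map_mx ratr q).
  apply: cmin; rewrite inE /A/= (le_trans Gqk)// invf_le1 ?ltr0n//.
  by rewrite (ler_nat R 1 k.+1).
by move=> /le_trans/(_ Gqk); rewrite leNgt kGc.
Qed.

End rational_sublevel.

(** * Measurability of the failure event in c *)

Section failure_measurable.
Context {R : realType} (N : nat).
Local Notation C := R[i].
Local Notation normc := (@ComplexField.Normc.normc R).

(** Generators of the product sigma-algebra on coefficient vectors. They are stable under
    intersection, so laws can be compared on them. *)
Definition box : set (set ('I_N -> borelC R)) :=
  [set B | exists2 A : 'I_N -> set (borelC R),
     (forall k, measurable (A k)) & B = [set z | forall k, A k (z k)]].

Definition signals := g_sigma_algebraType box.

Lemma open_Re (x : R) : open [set z : C^o | x < complex.Re z].
Proof.
rewrite openE => z /= xz; apply/nbhs_ballP.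
exists (complex.Re z - x)%:C%C => /=; first by rewrite ltcR subr_gt0.
move=> y; rewrite /ball/= normrE ltcR => h.
have := le_lt_trans (ler_Re_normc _) h; rewrite ReD ReN ltr_norml => /andP[_].
lra.
Qed.

Lemma open_Im (x : R) : open [set z : C^o | x < complex.Im z].
Proof.
rewrite openE => z /= xz; apply/nbhs_ballP.
exists (complex.Im z - x)%:C%C => /=; first by rewrite ltcR subr_gt0.
move=> y; rewrite /ball/= normrE ltcR => h.
have := le_lt_trans (ler_Im_normc _) h; rewrite ImD ImN ltr_norml => /andP[_].
lra.
Qed.

Lemma measurable_Re : measurable_fun setT (@complex.Re R : borelC R -> R).
Proof.
apply: (measurability _ (RGenOInfty.measurableE R)).
move=> _ [_ [x ->] <-]; rewrite setTI; apply: sub_sigma_algebra.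
rewrite (_ : _ @^-1` _ = [set z : C^o | x < complex.Re z]); first exact: open_Re.
by apply/seteqP; split=> z /=; rewrite in_itv/= andbT.
Qed.

Lemma measurable_Im : measurable_fun setT (@complex.Im R : borelC R -> R).
Proof.
apply: (measurability _ (RGenOInfty.measurableE R)).
move=> _ [_ [x ->] <-]; rewrite setTI; apply: sub_sigma_algebra.
rewrite (_ : _ @^-1` _ = [set z : C^o | x < complex.Im z]); first exact: open_Im.
by apply/seteqP; split=> z /=; rewrite in_itv/= andbT.
Qed.

Lemma measurable_coordinate k : measurable_fun setT (fun z : signals => z k).
Proof.
move=> _ A mA; rewrite setTI; apply: sub_sigma_algebra.
exists (fun j => if j == k then A else setT).
  by move=> j; case: ifP.
apply/seteqP; split=> z /= => [Az j|/(_ k)]; last by rewrite eqxx.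
by case: eqP => [->|].
Qed.

Lemma measurable_Re_sum (a : 'I_N -> C) :
  measurable_fun setT (fun z : signals => complex.Re (\sum_k a k * z k)).
Proof.
rewrite (_ : (fun _ => _) = fun z : signals =>
  \sum_k (complex.Re (a k) * complex.Re (z k) - complex.Im (a k) * complex.Im (z k))); last first.
  by apply/funext => z; rewrite Re_sum; apply: eq_bigr => k _; rewrite ReM.
apply: measurable_sum => k; apply: measurable_funB; apply: measurable_funM => //.
  exact: measurableT_comp measurable_Re (measurable_coordinate k).
exact: measurableT_comp measurable_Im (measurable_coordinate k).
Qed.

Lemma measurable_Im_sum (a : 'I_N -> C) :
  measurable_fun setT (fun z : signals => complex.Im (\sum_k a k * z k)).
Proof.
rewrite (_ : (fun _ => _) = fun z : signals =>
  \sum_k (complex.Re (a k) * complex.Im (z k) + complex.Im (a k) * complex.Re (z k))); last first.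
  by apply/funext => z; rewrite Im_sum; apply: eq_bigr => k _; rewrite ImM.
apply: measurable_sum => k; apply: measurable_funD; apply: measurable_funM => //.
  exact: measurableT_comp measurable_Im (measurable_coordinate k).
exact: measurableT_comp measurable_Re (measurable_coordinate k).
Qed.

(** Real coordinates on C^N, in which rational density and compactness are available. *)
Definition decode (q : 'rV[R]_(N + N)) : 'cV[C]_N :=
  \col_j (q 0 (lshift N j) +i* q 0 (rshift N j))%C.

Definition encode (x : 'cV[C]_N) : 'rV[R]_(N + N) :=
  row_mx (\row_j complex.Re (x j 0)) (\row_j complex.Im (x j 0)).

Lemma encodeK : cancel encode decode.
Proof.
move=> x; apply/colP => j; rewrite mxE row_mxEl row_mxEr !mxE.
by case: (x j 0).
Qed.

Lemma Re_decode_continuous j : continuous (fun q => complex.Re (decode q j 0)).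
Proof.
rewrite (_ : (fun _ => _) = (fun q : 'rV[R]_(N + N) => q 0 (lshift N j))).
  exact: coord_continuous.
by apply/funext => q; rewrite mxE.
Qed.

Lemma Im_decode_continuous j : continuous (fun q => complex.Im (decode q j 0)).
Proof.
rewrite (_ : (fun _ => _) = (fun q : 'rV[R]_(N + N) => q 0 (rshift N j))).
  exact: coord_continuous.
by apply/funext => q; rewrite mxE.
Qed.

Lemma sum_continuous (T : topologicalType) (I : finType) (F : I -> T -> R) :
  (forall i, continuous (F i)) -> continuous (fun x => \sum_i F i x).
Proof.
move=> Fc x; rewrite /continuous_at.
elim: (index_enum I) => [|i s IH].
  by rewrite big_nil; under eq_fun do rewrite big_nil; exact: cvg_cst.
rewrite big_cons; under eq_fun do rewrite big_cons.
by apply: cvgD => //; exact: Fc.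
Qed.

Lemma sum_sqr_continuous (T : topologicalType) (f g : T -> R) :
  continuous f -> continuous g -> continuous (fun x => f x ^+ 2 + g x ^+ 2).
Proof.
move=> fc gc x; apply: (@continuousD R R^o T (fun x => f x ^+ 2) (fun x => g x ^+ 2)).
  exact: (@continuousM R T f f x (fc x) (fc x)).
exact: (@continuousM R T g g x (gc x) (gc x)).
Qed.

Lemma affine_continuous (T : topologicalType) (a b : R) (f g : T -> R) :
  continuous f -> continuous g -> continuous (fun x => a * f x + b * g x).
Proof.
move=> fc gc x; apply: (@continuousD R R^o T (fun x => a * f x) (fun x => b * g x)).
  exact: (@continuousM R T (cst a) f x (@cst_continuous _ _ a _) (fc x)).
exact: (@continuousM R T (cst b) g x (@cst_continuous _ _ b _) (gc x)).
Qed.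

Lemma norm1_decode_continuous (alpha : 'cV[C]_N) :
  continuous (fun q => norm1 (alpha + decode q)).
Proof.
apply: sum_continuous => j.
rewrite (_ : (fun q : 'rV[R]_(N + N) => _) =
  (fun q => Num.sqrt (complex.Re ((alpha + decode q) j 0) ^+ 2 +
                      complex.Im ((alpha + decode q) j 0) ^+ 2))); last first.
  apply/funext => q; rewrite -normc_sqr sqrtr_sqr.
  by rewrite ger0_norm// normc_ge0.
move=> q; apply: continuous_comp; last exact: sqrt_continuous.
apply: sum_sqr_continuous => {}q; under eq_fun do rewrite mxE (ReD, ImD).
  by apply: continuousD; [exact: cst_continuous|exact: Re_decode_continuous].
by apply: continuousD; [exact: cst_continuous|exact: Im_decode_continuous].
Qed.

Variables (m : nat) (Phi Psi : 'M[C]_N) (alpha : 'cV[C]_N) (lam : 'I_m -> 'I_N).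

Definition residual (z : 'I_N -> C) (x : 'cV[C]_N) : R :=
  \sum_r normc ((rowsub lam (modulated Phi Psi z) *m x) r 0) ^+ 2.

Lemma residual_ge0 z x : 0 <= residual z x.
Proof. by apply: sumr_ge0 => r _; exact: sqr_ge0. Qed.

Lemma residual_eq0 z x :
  (residual z x == 0) = (rowsub lam (modulated Phi Psi z) *m x == 0).
Proof.
apply/eqP/eqP => [|Ax0]; last first.
  by rewrite /residual big1// => r _; rewrite Ax0 mxE normc0 expr0n.
move=> /psumr_eq0P h; apply/colP => r; rewrite [RHS]mxE; apply/eqP.
by rewrite -normc_eq0 -sqrf_eq0 h// => i _; exact: sqr_ge0.
Qed.

Lemma measurable_residual x : measurable_fun setT (fun z : signals => residual z x).
Proof.
apply: measurable_sum => r.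
pose a k := (Phi k (lam r))^* * \sum_j Psi k j * x j 0.
rewrite (_ : (fun _ => _) = fun z : signals =>
    complex.Re (\sum_k a k * z k) ^+ 2 + complex.Im (\sum_k a k * z k) ^+ 2).
  apply: measurable_funD; apply: measurable_funX.
    exact: measurable_Re_sum.
  exact: measurable_Im_sum.
apply/funext => z; rewrite -normc_sqr; congr (normc _ ^+ 2).
rewrite mxE; under eq_bigr do rewrite mxE modulatedE mulr_suml.
rewrite exchange_big/=; apply: eq_bigr => k _.
rewrite /a mulrAC mulr_sumr; apply: eq_bigr => j _; ring.
Qed.

Lemma residual_continuous z : continuous (fun q => residual z (decode q)).
Proof.
pose A := rowsub lam (modulated Phi Psi z).
apply: sum_continuous => r.
under eq_fun do rewrite normc_sqr mxE Re_sum Im_sum.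
apply: sum_sqr_continuous.
  under eq_fun do under eq_bigr do rewrite ReM -mulNr.
  apply: sum_continuous => j; apply: affine_continuous.
    exact: Re_decode_continuous.
  exact: Im_decode_continuous.
under eq_fun do under eq_bigr do rewrite ImM.
apply: sum_continuous => j; apply: affine_continuous.
  exact: Im_decode_continuous.
exact: Re_decode_continuous.
Qed.

(** Failure means a nonzero kernel vector [x] with alpha + x no longer than alpha in l1 norm.
    Nonzero is written as a lower bound 1/(n+1), a closed condition, so that compactness applies for
    each [n]. *)
Lemma not_recoversP z : ~ recovers Phi Psi alpha z lam <->
  exists n : nat, exists x, [/\ n.+1%:R^-1 <= norm1 x,
    norm1 (alpha + x) <= norm1 alpha & residual z x <= 0].
Proof.
set A := rowsub lam (modulated Phi Psi z).
have res0 x : residual z x <= 0 <-> A *m x = 0.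
  rewrite le_eqVlt ltNge residual_ge0 orbF residual_eq0.
  by split=> /eqP.
have norm1_ge0 (x : 'cV[C]_N) : 0 <= norm1 x.
  by apply: sumr_ge0 => ? _; exact: normc_ge0.
split=> [nrec|[n [x [nx alphax /res0 Ax0]]] [[_ amin] uniq]].
  apply: contrapT => /forallNP noex; apply: nrec.
  have key x : A *m alpha = A *m x -> norm1 x <= norm1 alpha -> x = alpha.
    move=> Ax nx; apply: contrapT => xalpha.
    have : 0 < norm1 (x - alpha).
      rewrite lt_neqAle norm1_ge0 andbT eq_sym; apply/eqP => n0; apply: xalpha.
      apply/eqP; rewrite -subr_eq0; apply/eqP/colP => j; rewrite [RHS]mxE.
      apply/eqP; rewrite -normc_eq0; apply/eqP.
      by apply: (psumr_eq0P _ n0) => // i _; exact: normc_ge0.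
    move=> /ltr_add_invr[n]; rewrite add0r => nlt; apply: (noex n).
    exists (x - alpha); split; [exact: ltW|by rewrite addrC subrK|].
    by apply/res0; rewrite mulmxBr Ax subrr.
  split=> [|x [Ax /(_ alpha erefl)]]; last exact: key.
  split=> // x Ax; rewrite leNgt; apply/negP => nx.
  by have xa := key x Ax (ltW nx); rewrite xa ltxx in nx.
have minx : l1_minimizer A (A *m alpha) (alpha + x).
  split; first by rewrite mulmxDr Ax0 addr0.
  by move=> x' Ax'; rewrite (le_trans alphax)// amin.
have x0 : x = 0 by apply: (addrI alpha); rewrite addr0; exact: uniq.
have : n.+1%:R^-1 <= 0 :> R.
  rewrite (le_trans nx)// x0 /norm1 big1// => j _.
  by rewrite mxE normc0.
by rewrite leNgt invr_gt0 ltr0n.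
Qed.

(** Nonpositive exactly when [q] satisfies the three conditions of [not_recoversP]. The second one
    keeps the sublevel set at 1 bounded. *)
Definition failure_gap n (z : 'I_N -> C) (q : 'rV[R]_(N + N)) : R :=
  Num.max (Num.max (n.+1%:R^-1 - norm1 (decode q))
     (norm1 (alpha + decode q) - norm1 alpha)) (residual z (decode q)).

Lemma failure_gap_continuous n z : continuous (failure_gap n z).
Proof.
move=> q.
apply: (@continuous_max R _ (fun q => Num.max (n.+1%:R^-1 - norm1 (decode q))
    (norm1 (alpha + decode q) - norm1 alpha)) (fun q => residual z (decode q)));
  last exact: residual_continuous.
apply: (@continuous_max R _ (fun q => n.+1%:R^-1 - norm1 (decode q))
    (fun q => norm1 (alpha + decode q) - norm1 alpha)); last first.
  by apply: continuousB; [exact: norm1_decode_continuous|exact: cst_continuous].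
apply: continuousB; first exact: cst_continuous.
rewrite (_ : (fun q => norm1 (decode q)) = (fun q => norm1 (0 + decode q))).
  exact: norm1_decode_continuous.
by apply/funext => q'; rewrite add0r.
Qed.

Lemma failure_gap_le1 n z q : failure_gap n z q <= 1 ->
  forall i, `|q 0 i| <= 2 * norm1 alpha + 1.
Proof.
rewrite !ge_max => /andP[/andP[_ gap1] _] i.
have normc_le_norm1 (x : 'cV[C]_N) j : normc (x j 0) <= norm1 x.
  by rewrite /norm1 (bigD1 j)//= lerDl sumr_ge0// => k _; exact: normc_ge0.
have coord j : normc (decode q j 0) <= 2 * norm1 alpha + 1.
  have : normc (decode q j 0) <= normc ((alpha + decode q) j 0) + normc (alpha j 0).
    by apply: le_trans (ler_normcB _ _); rewrite [(alpha + _) j 0]mxE addrAC subrr add0r.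
  have := normc_le_norm1 (alpha + decode q) j.
  have := normc_le_norm1 alpha j; lra.
rewrite -(splitK i); case: (fintype.split i) => j /=.
  by apply: le_trans (coord j); apply: le_trans (ler_Re_normc _); rewrite mxE.
by apply: le_trans (coord j); apply: le_trans (ler_Im_normc _); rewrite mxE.
Qed.

Lemma measurable_not_recovers :
  measurable [set z : signals | ~ recovers Phi Psi alpha z lam].
Proof.
rewrite (_ : [set z | _] = \bigcup_n \bigcap_k \bigcup_(q : 'rV[rat]_(N + N))
    [set z | failure_gap n z (map_mx ratr q) <= k.+1%:R^-1]).
  apply: bigcupT_measurable => n; apply: bigcapT_measurable => k.
  apply: countable_bigcupT_measurable => // q.
  rewrite -[X in measurable X]setTI.
  apply: (@measurable_fun_le _ _ R setT
    (fun z : signals => failure_gap n z (map_mx ratr q)) (cst k.+1%:R^-1)) => //.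
  (* For fixed [q] only the residual depends on [z]. *)
  apply: measurable_maxr; first exact: measurable_cst.
  exact: measurable_residual.
apply/seteqP; split=> z /=.
- move=> /not_recoversP[n [x [nx ax rx]]]; exists n => // k _.
  have [h _] := sublevel_rat (@failure_gap_continuous n z) (@failure_gap_le1 n z).
  have [|q qk] := h _ k; last by exists q.
  exists (encode x).
  by rewrite /failure_gap encodeK !ge_max !subr_le0 nx ax rx.
- move=> [n _ hn]; apply/not_recoversP; exists n.
  have [_ h] := sublevel_rat (@failure_gap_continuous n z) (@failure_gap_le1 n z).
  have [k|q] := h; first by have [q _ qk] := hn k I; exists q.
  by rewrite !ge_max !subr_le0 => /andP[/andP[nx ax] rx]; exists (decode q).
Qed.

End failure_measurable.

(** * Symmetry of the Rademacher and Steinhaus laws *)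

Section symmetric_laws.
Context {R : realType}.
Local Notation C := R[i].
Local Notation normc := (@ComplexField.Normc.normc R).
Local Notation mu := (@lebesgue_measure R).

Lemma borelCE : @measurable _ (borelC R) = <<s @open C^o >>.
Proof. by []. Qed.

Lemma measurable_oppC : measurable_fun setT (-%R : borelC R -> borelC R).
Proof.
apply: (measurability _ borelCE).
move=> _ [A oA <-]; rewrite setTI; apply: sub_sigma_algebra.
exact: (proj1 (continuousP _) (@opp_continuous C^o)).
Qed.

Lemma measurable_preimage_oppC (A : set (borelC R)) : measurable A ->
  measurable [set z : borelC R | A (- z)].
Proof. by move=> mA; have := measurable_oppC measurableT mA; rewrite setTI. Qed.

Lemma measurable_circle : measurable [set z : borelC R | normc z = 1].
Proof.
have mf : measurable_fun setT (fun z : borelC R => complex.Re z ^+ 2 + complex.Im z ^+ 2).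
  by apply: measurable_funD; apply: measurable_funX;
    [exact: measurable_Re|exact: measurable_Im].
rewrite (_ : [set _ | _] = (fun z : borelC R => complex.Re z ^+ 2 + complex.Im z ^+ 2)
   @^-1` [set 1]).
  by rewrite -[X in measurable X]setTI; apply: mf => //; exact: measurable_set1.
apply/seteqP; split=> z /=; first by move=> z1; rewrite -normc_sqr z1 expr1n.
by rewrite -normc_sqr => /eqP; rewrite sqrp_eq1 ?normc_ge0// => /eqP.
Qed.

Lemma lebesgue_measure_shift (a : R) (A : set R) : measurable A ->
  mu [set x | A (x + a)] = mu A.
Proof.
move=> mA.
have mf : @measurable_fun _ _ (measurableTypeR R) (measurableTypeR R) setT (fun x => x + a).
  by apply: measurable_funD => //; exact: measurable_cst.
pose f : {mfun measurableTypeR R >-> measurableTypeR R} := 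
    @mfun_Sub _ _ (measurableTypeR R) (measurableTypeR R) _ (mem_set mf).
suff : mu A = pushforward mu f A by [].
apply: lebesgue_measure_unique => //= _ [[x y]] _ <-.
rewrite /pushforward (_ : _ @^-1` _ = `]x - a, y - a]%classic).
  rewrite !lebesgue_measure_itv/= !lte_fin ltrD2r.
  by case: ifP => // _; congr (_%:E); ring.
by apply/seteqP; split=> z /=; rewrite !in_itv/= ltrBlDr lerBrDr.
Qed.

(** Dropping the endpoint, a null set, lets a shift by 1/2 match the two half-open halves
    exactly. *)
Lemma uniform_prob01E (A : set R) : measurable A ->
  uniform_prob (@ltr01 R) A = mu (A `&` `[0, 1[%classic).
Proof.
move=> mA; rewrite /uniform_prob integral_uniform_pdf.
rewrite (eq_integral (fun=> 1%E)); last first.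
  by move=> x; rewrite inE/= => -[_]; rewrite in_itv/= /uniform_pdf subr0 invr1 => ->.
rewrite integral_cst/= ?mul1e//; last exact: measurableI.
have -> : A `&` `[0, 1]%classic = (A `&` `[0, 1[%classic) `|` (A `&` [set 1]).
  apply/seteqP; split=> x /=; rewrite !in_itv/=.
    move=> [Ax /andP[-> x1]]; have [_|x1'] := ltP x 1; [by left|right].
    by split=> //; apply/eqP; rewrite eq_le x1 x1'.
  by move=> [[Ax /andP[-> /ltW->]]|[+ x1]]; rewrite ?x1 ?ler01 ?lexx.
apply/eqP; rewrite eq_le; apply/andP; split; last first.
  apply: le_measure; rewrite ?inE; [| |exact: subsetUl].
    exact: measurableI.
  by apply: measurableU; apply: measurableI.
apply: le_trans (measureU2 _ _ _) _ => /=; [exact: measurableI|exact: measurableI|].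
rewrite [X in (_ + X)%E](_ : _ = 0%E) ?adde0//.
apply/eqP; rewrite eq_le measure_ge0 andbT.
apply: (@le_trans _ _ (mu [set 1])); last by rewrite lebesgue_measure_set1.
by apply: le_measure; rewrite ?inE//; exact: measurableI.
Qed.

(** The shift carries the part of [B] in the lower half onto the part of [A] in the upper half, and
    likewise with [A] and [B] exchanged, so the masses of the halves are swapped. *)
Lemma uniform_prob_half_shift (A B : set R) : measurable A -> measurable B ->
  (forall t, A (t + 2^-1) <-> B t) -> (forall t, B (t + 2^-1) <-> A t) ->
  uniform_prob (@ltr01 R) A = uniform_prob (@ltr01 R) B.
Proof.
move=> mA mB AB BA; rewrite !uniform_prob01E//.
pose lo := `[(0 : R), 2^-1[%classic; pose hi := `[(2^-1 : R), 1[%classic.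
have mlo : measurable lo by exact: measurable_itv.
have mhi : measurable hi by exact: measurable_itv.
have split01 (D : set R) : measurable D -> mu (D `&` `[0, 1[%classic) =
    (mu (D `&` lo) + mu (D `&` hi))%E.
  move=> mD; rewrite -measureU//=; last 3 first.
  - exact: measurableI.
  - exact: measurableI.
  - by rewrite /lo /hi; apply/seteqP; split=> // x /= [[_ +] [_]]; rewrite !in_itv/= => /andP[_ h1] /andP[h2 _]; lra.
  rewrite -setIUr; congr (mu (_ `&` _)).
  rewrite /lo /hi; apply/seteqP; split=> x /=; rewrite !in_itv/=.
    by case: (ltP x 2^-1) => h /andP[-> ->]; [left|right].
  by case=> /andP[h1 h2]; apply/andP; split; lra.
have half (D E : set R) : measurable D -> (forall t, D (t + 2^-1) <-> E t) ->
    mu (E `&` lo) = mu (D `&` hi).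
  move=> mD DE; rewrite -(lebesgue_measure_shift 2^-1 (measurableI _ _ mD (measurable_itv _))).
  congr (mu _); rewrite /lo /hi; apply/seteqP; split=> x /=; rewrite !in_itv/=.
    by move=> [/DE Dx /andP[h1 h2]]; split=> //; apply/andP; split; lra.
  by move=> [/DE Dx /andP[h1 h2]]; split=> //; apply/andP; split; lra.
by rewrite (split01 A)// (split01 B)// (half _ _ mB BA) (half _ _ mA AB) addeC.
Qed.

Lemma unit_circle_half (t : R) : unit_circle (t + 2^-1) = - unit_circle t.
Proof.
rewrite /unit_circle mulrDr (_ : 2 * pi * 2^-1 = pi); last by field.
by rewrite cosDpi sinDpi.
Qed.

Lemma normc_unit_circle (t : R) : normc (unit_circle t) = 1.
Proof. by rewrite /= cos2Dsin2 sqrtr1. Qed.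

Lemma continuous_unit_circle : continuous (@unit_circle R : R -> C^o).
Proof.
move=> t; apply/cvgrPdist_lt => /= e e0.
have eE : e = (complex.Re e)%:C%C.
  by rewrite RRe_real// ger0_real// ltW.
have e0' : 0 < complex.Re e / 2 by rewrite divr_gt0// -(ltcR 0) -eE.
have ccont : {for t, continuous (fun x : R => cos (2 * pi * x))}.
  apply: continuous_comp; last exact: continuous_cos.
  exact: (@continuousM R R (cst (2 * pi)) id t (@cst_continuous _ _ _ _) (fun _ h => h)).
have scont : {for t, continuous (fun x : R => sin (2 * pi * x))}.
  apply: continuous_comp; last exact: continuous_sin.
  exact: (@continuousM R R (cst (2 * pi)) id t (@cst_continuous _ _ _ _) (fun _ h => h)).
move/cvgrPdist_lt: ccont => /(_ _ e0') ccont.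
move/cvgrPdist_lt: scont => /(_ _ e0') scont.
near=> x; rewrite normrE eE ltcR; apply: le_lt_trans (ler_normc_ReIm _) _.
rewrite ReD ImD ReN ImN /=.
have : `|cos (2 * pi * t) - cos (2 * pi * x)| < complex.Re e / 2.
  by near: x; exact: ccont.
have : `|sin (2 * pi * t) - sin (2 * pi * x)| < complex.Re e / 2.
  by near: x; exact: scont.
lra.
Unshelve. all: by end_near.
Qed.

Lemma measurable_unit_circle : measurable_fun setT (@unit_circle R : R -> borelC R).
Proof.
apply: (measurability _ borelCE).
move=> _ [A oA <-]; rewrite setTI; apply: open_measurable.
exact: (proj1 (continuousP _) continuous_unit_circle).
Qed.

Section laws.
Context d {T : measurableType d} (P : probability T R).
Implicit Types X : {RV P >-> borelC R}.

(** Both laws enter only through invariance under negation and concentration on the unit circle. *)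
Definition admissible X : Prop := rademacher X \/ steinhaus X.

Lemma measurable_RV X (A : set (borelC R)) : measurable A -> measurable (X @^-1` A).
Proof. by move=> mA; rewrite -[X in measurable X]setTI; exact: measurable_funP. Qed.

Lemma measurable_pt (a : C) : measurable [set a : borelC R].
Proof.
rewrite -[X in measurable X]setCK; apply: measurableC; apply: sub_sigma_algebra.
apply: closed_openC; apply: accessible_closed_set1.
exact: hausdorff_accessible (@norm_hausdorff _ C^o).
Qed.

Lemma probability_full (A D : set T) : measurable A -> measurable D ->
  P D = 1%E -> P (A `&` D) = P A.
Proof.
move=> mA mD PD; apply/eqP; rewrite eq_le; apply/andP; split.
  by apply: le_measure; rewrite ?inE//; exact: measurableI.
rewrite (measureDI P mA mD) [X in (X + _)%E](_ : _ = 0%E) ?add0e//.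
apply/eqP; rewrite eq_le measure_ge0 andbT.
have <- : P (~` D) = 0%E by rewrite probability_setC// PD subee.
by apply: le_measure; rewrite ?inE; [exact: measurableD|exact: measurableC|exact: subDsetr].
Qed.

(** The two atoms carry total mass 1, hence determine the law on every measurable set. *)
Lemma rademacherE X (A : set (borelC R)) : rademacher X -> measurable A ->
  P (X @^-1` A) = ((`[< A 1 >]%:R + `[< A (-1) >]%:R) / 2)%:E.
Proof.
move=> [X1 XN1] mA.
have m1 := measurable_RV X (measurable_pt 1).
have mN1 := measurable_RV X (measurable_pt (-1)).
have disj : X @^-1` [set 1] `&` X @^-1` [set -1] = set0.
  apply/seteqP; split=> // w /= [-> /eqP].
  by rewrite -subr_eq0 opprK -mulr2n pnatr_eq0.
have full : P (X @^-1` [set 1] `|` X @^-1` [set -1]) = 1%E.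
  by rewrite measureU// [X in (X + _)%E]X1 [X in (_ + X)%E]XN1 -EFinD; congr (_%:E); field.
rewrite -(probability_full (measurable_RV X mA) (measurableU _ _ m1 mN1) full).
have atom a : P (X @^-1` [set a]) = (2^-1)%:E ->
    P (X @^-1` A `&` X @^-1` [set a]) = (`[< A a >]%:R / 2)%:E.
  case: asboolP => Aa Pa.
    by rewrite mul1r -Pa; congr (P _); apply/seteqP; split=> w /=; [case|move=> ->].
  rewrite mul0r; transitivity (P set0); last by rewrite measure0.
  congr (P _); apply/seteqP; split=> // w /= [+ Xa].
  by rewrite Xa.
rewrite setIUr measureU.
- by rewrite [X in (X + _)%E]atom// [X in (_ + X)%E]atom// -EFinD mulrDl.
- exact: measurableI (measurable_RV X mA) m1.
- exact: measurableI (measurable_RV X mA) mN1.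
- by rewrite setIACA disj setI0.
Qed.

(** Negation swaps the two Rademacher atoms; on the circle it is a half turn, that is a shift by 1/2
    of the uniform parameter. *)
Lemma admissible_opp X (A : set (borelC R)) : admissible X -> measurable A ->
  P (X @^-1` [set z | A (- z)]) = P (X @^-1` A).
Proof.
move=> [rX|sX] mA.
  rewrite !rademacherE//; last exact: measurable_preimage_oppC.
  by rewrite /= opprK addrC.
have mA' := measurable_preimage_oppC mA.
have := sX _ mA; have := sX _ mA'; rewrite /distribution/= /pushforward/= => -> ->.
have mu1 (B : set (borelC R)) : measurable B -> measurable (@unit_circle R @^-1` B).
  by move=> mB; rewrite -[X in measurable X]setTI; exact: measurable_unit_circle.
apply: uniform_prob_half_shift; [exact: mu1|exact: mu1| |] => t /=.
  by rewrite unit_circle_half opprK.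
by rewrite unit_circle_half.
Qed.

Lemma admissible_circle X : admissible X -> P (X @^-1` [set z | normc z = 1]) = 1%E.
Proof.
move=> [rX|sX].
  rewrite rademacherE//; last exact: measurable_circle.
  rewrite asboolT; last exact: normc1.
  rewrite asboolT; last exact: etrans (normcN _) normc1.
  by congr (_%:E); rewrite /=; field.
have := sX _ measurable_circle; rewrite /distribution/= /pushforward/= => ->.
rewrite (_ : _ @^-1` _ = setT) ?probability_setT//.
by apply/seteqP; split=> // t _; exact: normc_unit_circle.
Qed.

End laws.
End symmetric_laws.

(** * Integrating pointwise counts *)

Section averaging.
Context {R : realType} d {T : measurableType d} (P : probability T R).

(** The sum of probabilities is the integral of the number of events that occur, and a bound on this
    number is needed only almost surely. *)
Lemma sum_probability_le (I : finType) (B : I -> set T) (D : set T) (k : R) :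
  (forall i, measurable (B i)) -> measurable D -> P D = 1%E -> 0 <= k ->
  (forall w, D w -> \sum_i `[< B i w >]%:R <= k) ->
  (\sum_i P (B i) <= k%:E)%E.
Proof.
move=> mB mD PD k0 Bk.
have mBD i : measurable (B i `&` D) by exact: measurableI.
have -> : (\sum_i P (B i) = \sum_i \int[P]_(w in setT) (\1_(B i `&` D) w)%:E)%E.
  apply: eq_bigr => i _; rewrite integral_indic// setIT.
  exact: esym (probability_full (mB i) mD PD).
rewrite -ge0_integral_sum//; last first.
  by move=> i; apply/measurable_EFinP; exact: measurable_indic.
apply: (@le_trans _ _ (\int[P]_(w in setT) k%:E)%E); last first.
  by rewrite integral_cst// [X in (_ * X)%E]probability_setT mule1.
apply: ge0_le_integral => //.
- by move=> w _; apply: sume_ge0 => i _; rewrite lee_fin.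
- by apply: emeasurable_sum => i; apply/measurable_EFinP; exact: measurable_indic.
move=> w _; rewrite sumEFin lee_fin.
have [Dw|nDw] := pselect (D w); last first.
  by rewrite big1// => i _; rewrite indicE memNset// => -[].
apply: le_trans (Bk w Dw); apply: ler_sum => i _.
rewrite indicE; case: asboolP => Bw; first by rewrite lern1 leq_b1.
by rewrite memNset// => -[].
Qed.

Lemma probability_le_sum (I : finType) (B : I -> set T) (A : set T) :
  (forall i, measurable (B i)) -> measurable A -> (A `<=` \bigcup_i B i) ->
  (P A <= \sum_i P (B i))%E.
Proof.
move=> mB mA AB.
have step (s : seq I) : measurable (\big[setU/set0]_(i <- s) B i) /\
    (P (\big[setU/set0]_(i <- s) B i) <= \sum_(i <- s) P (B i))%E.
  elim: s => [|i s [ms IH]]; first by rewrite !big_nil measure0.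
  rewrite !big_cons; split; first exact: measurableU.
  by apply: le_trans (measureU2 _ _ _) _ => //; rewrite leeD2l.
have [ms Ps] := step (index_enum I).
apply: le_trans Ps; apply: le_measure; rewrite ?inE//.
by rewrite -bigcup_seq => w /AB[i _ Bi]; exists i => //=; rewrite mem_index_enum.
Qed.

End averaging.

(** * Joint law of the coefficients and the rows *)

Section joint_law.
Context {R : realType} d {T : measurableType d} (P : probability T R).
Local Notation C := R[i].
Local Notation normc := (@ComplexField.Normc.normc R).
Variables (N m : nat) (c : 'I_N -> {RV P >-> borelC R}) (l : 'I_m -> T -> 'I_N).
Hypothesis c_admissible : forall k, admissible (c k).
Hypothesis l_uniform : forall r, uniform_index P (l r).
Hypothesis independent : independent_draws c l.

Definition same_indices (lam : 'I_m -> 'I_N) : set T :=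
  \bigcap_(r in [set: 'I_m]) (l r @^-1` [set lam r]).

Lemma measurable_same_indices lam : measurable (same_indices lam).
Proof.
apply: fin_bigcap_measurable => [|r _]; first exact: finite_finset.
exact: (l_uniform r (lam r)).1.
Qed.

Lemma rectangle_probability (A : 'I_N -> set (borelC R)) (B : 'I_m -> set 'I_N) :
  (forall k, measurable (A k)) ->
  P ((\bigcap_(k in [set: 'I_N]) (c k @^-1` A k)) `&`
     (\bigcap_(r in [set: 'I_m]) (l r @^-1` B r))) =
  ((\prod_k P (c k @^-1` A k)) * (\prod_r P (l r @^-1` B r)))%E.
Proof.
move=> mA.
pose E (i : 'I_N + 'I_m) : set T := match i with
  | inl k => c k @^-1` A k | inr r => l r @^-1` B r end.
have := independent (J := [set: 'I_N + 'I_m]%SET) (E := E).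
rewrite big_sumType/= => h.
transitivity (P (\bigcap_(i in [set` [set: 'I_N + 'I_m]%SET]) E i)).
  congr (P _); apply/seteqP; split=> w /=.
    by move=> [cA lB] [k|r] _; [exact: cA|exact: lB].
  by move=> h'; split=> [k _|r _]; [apply: (h' (inl k))|apply: (h' (inr r))]; rewrite /= inE.
rewrite h.
  by congr (_ * _)%E; apply: eq_bigl => i; rewrite inE.
move=> [k|r] _ /=; [exists (A k) => //|exists (B r) => //]; exact: setTI.
Qed.

Definition draw (w : T) : signals N := fun k => c k w.

Definition signed_draw (e : {ffun 'I_N -> bool}) (w : T) : signals N :=
  signed (draw w) e.

Lemma signed_draw_box e (A : 'I_N -> set (borelC R)) :
  signed_draw e @^-1` [set z | forall k, A k (z k)] =
  \bigcap_(k in [set: 'I_N])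
     (c k @^-1` (if e k then [set z | A k (- z)] else A k)).
Proof.
apply/seteqP; split=> w /= h k; have := h k; rewrite /signed_draw /signed /draw.
  by case: (e k) => + _; rewrite ?expr1 ?expr0 ?mulN1r ?mul1r.
by case: (e k) => /(_ I) /=; rewrite ?expr1 ?expr0 ?mulN1r ?mul1r.
Qed.

Lemma measurable_signed_draw e : measurable_fun setT (signed_draw e).
Proof.
apply: (measurability _ (erefl : @measurable _ (signals N) = <<s @box R N >>)).
move=> _ [_ [A mA ->] <-]; rewrite setTI signed_draw_box.
apply: fin_bigcap_measurable => [|k _]; first exact: finite_finset.
by apply: measurable_RV; case: (e k) => //; exact: measurable_preimage_oppC.
Qed.

Lemma draw_signed : draw = signed_draw [ffun=> false].
Proof. by apply/funext => w; apply/funext => k; rewrite /signed_draw /signed ffunE mul1r. Qed.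

Lemma box_setI_closed : setI_closed (@box R N).
Proof.
move=> _ _ [A mA ->] [B mB ->]; exists (fun k => A k `&` B k).
  by move=> k; exact: measurableI.
apply/seteqP; split=> z /=; first by move=> [hA hB] k; split.
by move=> h; split=> k; have [] := h k.
Qed.

(* By symmetry of the entries, the signs e may be chosen afterwards. *)
Lemma joint_law e lam (G : set (signals N)) : measurable G ->
  P (draw @^-1` G `&` same_indices lam) =
    ((N%:R^-1 ^+ m)%:E * P (signed_draw e @^-1` G))%E.
Proof.
move=> mG.
have mlam := measurable_same_indices lam.
have mdraw : measurable_fun setT draw by rewrite draw_signed; exact: measurable_signed_draw.
pose f2 : {mfun T >-> signals N} := mfun_Sub (mem_set (measurable_signed_draw e)).
have p0 : 0 <= N%:R^-1 ^+ m :> R by rewrite exprn_ge0// invr_ge0.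
pose p := NngNum p0.
(* Both sides are finite measures in [G], so it is enough to compare them on boxes, where
   independence factors them; N^-m is the probability of the rows [lam]. *)
suff : pushforward (mrestr P mlam) draw G = mscale p (distribution P f2) G by [].
pose m1 : {measure set (signals N) -> \bar R} :=
  measure_function_pushforward__canonical__measure_function_Measure (mrestr P mlam) mdraw.
pose m2 : {measure set (signals N) -> \bar R} := mscale p (distribution P f2).
apply: (@measure_unique _ R (signals N) (@box R N) (fun=> setT) _ _ _ _ m1 m2) => //.
- exact: box_setI_closed.
- by move=> _; exists (fun=> setT) => //; apply/seteqP; split.
- by apply/seteqP; split=> // z _; exists 0%N.
- move=> _ [A mA ->].
  change (P (draw @^-1` [set z | forall k, A k (z k)] `&` same_indices lam) =
    ((N%:R^-1 ^+ m)%:E * P (signed_draw e @^-1` [set z | forall k, A k (z k)]))%E).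
  have -> : draw @^-1` [set z | forall k, A k (z k)] =
      \bigcap_(k in [set: 'I_N]) (c k @^-1` A k).
    rewrite draw_signed signed_draw_box; apply: eq_bigcapr => k _.
    by rewrite ffunE.
  rewrite rectangle_probability//.
  rewrite signed_draw_box.
  have mA' k : measurable (if e k then [set z : borelC R | A k (- z)] else A k).
    by case: (e k) => //; exact: measurable_preimage_oppC.
  (* With no constraint on the rows, the rectangle gives the law of the coefficients alone. *)
  have := @rectangle_probability _ (fun=> setT) mA'.
  rewrite [X in _ `&` X](_ : _ = setT) ?setIT; last first.
    by apply/seteqP; split.
  move=> ->; rewrite [X in (_ * (_ * X))%E]big1 ?mule1; last first.
    by move=> r _; rewrite preimage_setT probability_setT.
  rewrite muleC; congr (_ * _)%E.
    under eq_bigr do rewrite (l_uniform _ _).2.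
    by rewrite prodEFin prodr_const card_ord.
  apply: eq_bigr => k _; case: (e k) => //.
  by rewrite admissible_opp.
- move=> _; change (P (draw @^-1` setT `&` same_indices lam) < +oo)%E.
  by rewrite preimage_setT setTI (le_lt_trans (probability_le1 _ mlam))// ltry.
Qed.

Lemma draw_circle : P [set w | forall k, normc (draw w k) = 1] = 1%E /\
  measurable [set w | forall k, normc (draw w k) = 1].
Proof.
have -> : [set w | forall k, normc (draw w k) = 1] =
   (\bigcap_(k in [set: 'I_N]) (c k @^-1` [set z | normc z = 1])) `&`
     (\bigcap_(r in [set: 'I_m]) (l r @^-1` setT)).
  apply/seteqP; split=> w /=; first by move=> h; split=> // k _; exact: h.
  by move=> [h _] k; exact: h.
split; last first.
  rewrite [X in _ `&` X](_ : _ = setT) ?setIT; last by apply/seteqP; split.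
  apply: fin_bigcap_measurable => [|k _]; first exact: finite_finset.
  exact: measurable_RV measurable_circle.
rewrite rectangle_probability; last by move=> _; exact: measurable_circle.
rewrite !big1 ?mule1// => [r _|k _]; first by rewrite preimage_setT probability_setT.
exact: admissible_circle.
Qed.

End joint_law.

(** * The failure probability *)

Section failure_probability.
Context {R : realType} d {T : measurableType d} (P : probability T R).
Local Notation C := R[i].
Local Notation normc := (@ComplexField.Normc.normc R).
Variables (N m s : nat) (c : 'I_N -> {RV P >-> borelC R}) (l : 'I_m -> T -> 'I_N).
Variables (Phi Psi : 'M[C]_N) (alpha : 'cV[C]_N) (rho : R).
Hypothesis c_admissible : forall k, admissible (c k).
Hypothesis l_uniform : forall r, uniform_index P (l r).
Hypothesis independent : independent_draws c l.
Hypothesis N_ge2 : (2 <= N)%N.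
Hypothesis rho_gt0 : 0 < rho.
Hypothesis Phi_unitary : Phi \is unitarymx.
Hypothesis Psi_unitary : Psi \is unitarymx.
Hypothesis s_ge1 : (1 <= s)%N.
Hypothesis alpha_sparse : sparse s alpha.
Hypothesis m_large : 2 ^+ 19 * (rho + 3) ^+ 3 * N%:R *
  modulus_coherence Phi Psi ^+ 2 * s%:R * ln (N%:R : R) ^+ 5 <= m%:R.

Let failing (lam : 'I_m -> 'I_N) : set (signals N) :=
  [set z | ~ recovers Phi Psi alpha z lam].

Let failure : set T :=
  [set w | ~ recovers Phi Psi alpha (draw c w) (fun r => l r w)].

Let mdraw : measurable_fun setT (draw c).
Proof. by rewrite draw_signed; exact: measurable_signed_draw. Qed.

Let atom (lam : {ffun 'I_m -> 'I_N}) : set T :=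
  draw c @^-1` failing lam `&` same_indices l lam.

Let measurable_atom lam : measurable (atom lam).
Proof.
apply: measurableI; last exact: measurable_same_indices.
rewrite -[X in measurable X]setTI; apply: mdraw => //.
exact: measurable_not_recovers.
Qed.

Let failureE : failure = \bigcup_lam atom lam.
Proof.
apply/seteqP; split=> w /=.
  have lE : (fun r => l r w) = [ffun r => l r w] by apply/funext => r; rewrite ffunE.
  by move=> h; exists [ffun r => l r w] => //; split=> [|r _] /=; rewrite ?ffunE// -lE.
move=> [lam _ [h same]]; rewrite /failure/=.
by rewrite (_ : (fun r => l r w) = lam)//; apply/funext => r; exact: same.
Qed.

Lemma measurable_failure : measurable failure.
Proof.
rewrite failureE; apply: fin_bigcup_measurable => [|lam _]; first exact: finite_finset.
exact: measurable_atom.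
Qed.

(** Each of the 2^N sign patterns gives its own bound on the same probability. Adding them produces
    the expected number of failing pairs, which is bounded for every c of modulus one. *)
Lemma failure_probability : (P failure <= (16 * N%:R `^ (- rho))%:E)%E.
Proof.
pose B (p : {ffun 'I_N -> bool} * {ffun 'I_m -> 'I_N}) : set T :=
  signed_draw c p.1 @^-1` failing p.2.
have mB p : measurable (B p).
  rewrite -[X in measurable X]setTI; apply: measurable_signed_draw => //.
  exact: measurable_not_recovers.
have NR0 : 0 < N%:R :> R by rewrite ltr0n (leq_trans _ N_ge2).
pose K : R := 16 * N%:R `^ (- rho) * (2 ^+ N * N%:R ^+ m).
have K0 : 0 <= K by rewrite mulr_ge0 ?mulr_ge0 ?exprn_ge0 ?powR_ge0.
have [circ mcirc] := draw_circle c_admissible independent.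
have sumB : (\sum_p P (B p) <= K%:E)%E.
  apply: sum_probability_le mB mcirc circ K0 _ => w wcirc.
  have := card_failures N_ge2 rho_gt0 Phi_unitary Psi_unitary wcirc s_ge1
    alpha_sparse m_large.
  apply: le_trans; rewrite natr_sum -(pair_bigA _ (fun e f => `[< B (e, f) w >]%:R))/=.
  apply: ler_sum => e _; rewrite -sum1_card natr_sum [leRHS]big_mkcond/=.
  by apply: ler_sum => f _; rewrite inE asbool_neg; case: ifP.
have PB p : P (B p) = (fine (P (B p)))%:E by rewrite fineK// fin_num_measure.
have PF : P failure = (fine (P failure))%:E.
  by rewrite fineK// fin_num_measure//; exact: measurable_failure.
(* Failure is split according to the rows drawn; [joint_law] then puts the signs [e] on c and
   factors out N^-m. *)
have step e : fine (P failure) <=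
    N%:R^-1 ^+ m * \sum_(f : {ffun 'I_m -> 'I_N}) fine (P (B (e, f))).
  rewrite -lee_fin -PF mulr_sumr -sumEFin.
  have le1 : (P failure <= \sum_lam P (atom lam))%E.
    apply: probability_le_sum measurable_atom measurable_failure _.
    by rewrite failureE.
  apply: (le_trans le1); apply: lee_sum => f _.
  rewrite (joint_law c_admissible l_uniform independent e); last first.
    exact: measurable_not_recovers.
  by rewrite -[X in (_ * X)%E]/(P (B (e, f))) PB -EFinM.
have sumBR : \sum_p fine (P (B p)) <= K.
  by rewrite -lee_fin -sumEFin; under eq_bigr do rewrite -PB.
(* The left side is 2^N copies of the failure probability; 2^N and N^m cancel against the factors of
   [K]. *)
have : \sum_(e : {ffun 'I_N -> bool}) fine (P failure) <= N%:R^-1 ^+ m * K.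
  apply: le_trans (ler_sum _ (fun e _ => step e)) _.
  rewrite -mulr_sumr ler_wpM2l ?exprn_ge0 ?invr_ge0//.
  by rewrite (pair_bigA _ (fun e f => fine (P (B (e, f)))))/=;
    under eq_bigr do rewrite -surjective_pairing.
rewrite sumr_const card_ffun card_bool card_ord -[leLHS]mulr_natl natrX.
have -> : N%:R^-1 ^+ m * K = 2 ^+ N * (16 * N%:R `^ (- rho)).
  by rewrite /K exprVn; field; rewrite gt_eqF ?exprn_gt0.
by rewrite ler_pM2l ?exprn_gt0// PF lee_fin.
Qed.

End failure_probability.

Theorem theorem3 (R : realType) :
  exists K : R, 0 < K /\
  forall rho : R, 0 < rho ->
  exists Crho : R, 0 < Crho /\
  forall (N : nat) (Phi Psi : 'M[R[i]]_N)
    (d : measure_display) (T : measurableType d) (P : probability T R)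
    (c : 'I_N -> {RV P >-> borelC R})
    (m : nat) (l : 'I_m -> T -> 'I_N)
    (s : nat) (alpha : 'cV[R[i]]_N),
  (2 <= N)%N -> rho < ln (N%:R : R) ^+ 3 ->
  Phi \is unitarymx -> Psi \is unitarymx ->
  (forall k, rademacher (c k)) \/ (forall k, steinhaus (c k)) ->
  (forall r, uniform_index P (l r)) ->
  independent_draws c l ->
  (1 <= s)%N -> sparse s alpha ->
  Crho * N%:R * modulus_coherence Phi Psi ^+ 2 * s%:R * ln (N%:R : R) ^+ 5
    <= m%:R ->
  ((1 - K * N%:R `^ (- rho))%:E <=
    P [set w | let A := rowsub (fun r => l r w)
                          (modulated Phi Psi (fun k => c k w)) in
               unique_l1_minimizer A (A *m alpha) alpha])%E.
Proof.
exists 16; split=> // rho rho0; exists (2 ^+ 19 * (rho + 3) ^+ 3).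
split; first by rewrite mulr_gt0 ?exprn_gt0// addr_gt0.
move=> N Phi Psi d T P c m l s alpha N2 _ Phiu Psiu crs lu indep s1 alphas mC.
have cadm k : admissible (c k) by case: crs => /(_ k) ?; [left|right].
have mF := measurable_failure c Phi Psi alpha lu.
have PF := failure_probability cadm lu indep N2 rho0 Phiu Psiu s1 alphas mC.
rewrite (_ : [set w | _] =
    ~` [set w | ~ recovers Phi Psi alpha (draw c w) (fun r => l r w)]).
  by rewrite probability_setC// EFinB leeB.
by apply/seteqP; split=> w /= => [h|/contrapT //]; apply.
Qed.
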